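(* For positive integers $j\le r$ and $\Re(s)>1$, \[ \xi(\{1\}_{j-1},2,\{1\}_{r-j};s)=\sum_{i=0}^{r-j}(-1)^i\binom{i+j}{i}\binom{s+r-i-j-1}{r-i-j}\zeta(i+j+1)\zeta(s+r-i-j)+(-1)^{r-j-1}\sum_{l=r-j}^{r}\binom{l}{r-j}\binom{s+r-l-1}{r-l}\zeta(l+1,s+r-l). \]
   Context: ${\rm Li}_{k_1,\ldots,k_r}(z)=\sum_{1\le n_1<\cdots<n_r}\frac{z^{n_r}}{n_1^{k_1}\cdots n_r^{k_r}}$. Arakawa–Kaneko function: $\xi(k_1,\ldots,k_r;s)=\frac{1}{\Gamma(s)}\int_0^\infty\frac{t^{s-1}}{e^t-1}{\rm Li}_{k_1,\ldots,k_r}(1-e^{-t})\,dt$. $\zeta(k_1,\ldots,k_{r-1},s)=\sum_{0<n_1<\cdots<n_r}\frac{1}{n_1^{k_1}\cdots n_{r-1}^{k_{r-1}}n_r^s}$; $\zeta(s)$ is the Riemann zeta function. $\{1\}_j$ denotes $j$ repetitions of $1$; $\binom{s+n-1}{n}=s(s+1)\cdots(s+n-1)/n!$. *)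

(* Defs.v *)
From mathcomp Require Import all_boot all_order all_algebra.
From mathcomp Require Import all_classical all_reals all_analysis.
From mathcomp Require Import complex.

Set Implicit Arguments.
Unset Strict Implicit.
Unset Printing Implicit Defensive.

Import Order.TTheory GRing.Theory Num.Theory.
Import numFieldNormedType.Exports.

Local Open Scope classical_set_scope.
Local Open Scope ring_scope.
Local Open Scope complex_scope.

(* \sum_(0 < n_1 < ... < n_r) f [:: n_1; ...; n_r], as the limit for N -> oo of
   the finite sums over 0 < n_1 < ... < n_r < N. *)
Definition multisum (K : numFieldType) (r : nat) (f : seq nat -> K) : K :=
  limn (fun N : nat =>
    \sum_(n : r.-tuple 'I_N | path ltn 0 (map val n)) f (map val n)).

Definition Li (K : numFieldType) (ks : seq nat) (z : K) : K :=
  multisum (size ks) (fun n =>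
    z ^+ last 0%N n / \prod_(i < size ks) (nth 0%N n i)%:R ^+ nth 0%N ks i).

Definition cexp (R : realType) (z : R[i]) : R[i] :=
  (expR (complex.Re z))%:C * (cos (complex.Im z) +i* sin (complex.Im z)).

(* Principal power; only meaningful for 0 < x. *)
Definition cpow (R : realType) (x : R) (s : R[i]) : R[i] := cexp (s * (ln x)%:C).

Definition Cintegral (R : realType) (D : set R) (f : R -> R[i]) : R[i] :=
  Rintegral lebesgue_measure D (fun x => complex.Re (f x)) +i*
  Rintegral lebesgue_measure D (fun x => complex.Im (f x)).

(* Euler's integral, for 0 < Re s. *)
Definition Gamma (R : realType) (s : R[i]) : R[i] :=
  Cintegral `]0, +oo[ (fun t => cpow t (s - 1) * (expR (- t))%:C).

Definition xi (R : realType) (ks : seq nat) (s : R[i]) : R[i] :=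
  (Gamma s)^-1 * Cintegral `]0, +oo[ (fun t =>
    cpow t (s - 1) / (expR t - 1)%:C * (Li ks (1 - expR (- t)))%:C).

(* The Riemann zeta function on the half-plane 1 < Re s. *)
Definition zeta (R : realType) (s : R[i]) : R[i] :=
  limn (fun N : nat => \sum_(1 <= n < N) (cpow n%:R s)^-1 : R[i]^o).

(* [mzeta [:: k_1; ...; k_(r-1)] s] is zeta(k_1, ..., k_(r-1), s). *)
Definition mzeta (R : realType) (ks : seq nat) (s : R[i]) : R[i] :=
  multisum (size ks).+1 (fun n =>
    ((\prod_(i < size ks) (nth 0%N n i)%:R ^+ nth 0%N ks i)
       * cpow (last 0%N n)%:R s)^-1).

(* binom(s + n - 1, n) = s (s + 1) ... (s + n - 1) / n!. *)
Definition rbinom (R : realType) (s : R[i]) (n : nat) : R[i] :=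
  (\prod_(i < n) (s + i%:R)) / (n`!)%:R.

(* Main.v *)
Require Import Defs.
From mathcomp Require Import all_boot all_order all_algebra.
From mathcomp Require Import all_classical all_reals all_analysis.
From mathcomp Require Import complex measurable_realfun ring lra zify.

(* On [0 < t] one has [Li_{1,..,1}(1 - e^-t) = t^j / j!] ([j] ones), so that
   [L m t := Li_{{1}_{j-1},2,{1}_m}(1 - e^-t)] satisfies [L m.+1' = L m] and
   [L 0' = t^j / j! / (e^t - 1)]. The combination
     [\sum_(i <= m) (-1)^i C(i+j,i) zeta(i+j+1) t^(m-i) / (m-i)!
        + (-1)^(m+1) \sum_(q <= j) C(m+q,m) t^(j-q) / (j-q)! Li_{m+q+1}(e^-t)]
   has the same derivatives and the same limit [0] at [0+], hence equals [L m t].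
   Integrating against [t^(s-1) / (e^t - 1)], expanding in powers of [e^-t] and using
   [\int t^(w-1) e^(-nt) = Gamma w * n^-w] turns each term into a product of a Gamma
   value with a zeta or a double zeta value; finally [Gamma (s + n) / (Gamma s * n!)]
   is [binom(s + n - 1, n)], which requires [Gamma s != 0]. *)

Set Implicit Arguments.
Unset Strict Implicit.
Unset Printing Implicit Defensive.

Import Order.TTheory GRing.Theory Num.Theory.
Import numFieldNormedType.Exports.

Local Open Scope classical_set_scope.
Local Open Scope ring_scope.
Local Open Scope complex_scope.

(** * Nested sums and their coefficients *)

(** A head exponent 0 marks the index that later carries the complex power. Thus [mcoef [:: 0]] is 1
    for 0 < n, which gives 1 / (e^t - 1) = Li_0(e^-t), and [mcoef [:: 0; l]] is the partial sum of
    m^-l over 0 < m < n, the coefficient of Li_l(x) x / (1 - x); its Dirichlet series at w is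
    zeta(l, w). The derivatives of the tail sum close up because the product rule produces
    differences of binomials, to which Pascal's rule applies. At 0+ the function Li_1(e^-t) is
    unbounded, but since j > 0 it only occurs with a positive power of t; what survives in both sums
    is C(m+j,m) zeta(m+j+1), with opposite signs. The delicate double zeta values have first
    exponent 1: their coefficients are the unbounded harmonic numbers. The Mellin lemma therefore
    admits growth n^d, compensated by the power t^d, here with d = j - q. For complex s, oscillation
    hides the nonvanishing of Gamma. It is proved far to the right, where t^(Re s - 1) e^-t is
    concentrated near its maximum, and pulled back by the functional equation. *)

(* The coefficient of [z ^+ n] in [Li (rev ks) z]: the list of exponents is reversed, so
   that its head belongs to the largest summation index. *)
Fixpoint mcoef (K : numFieldType) (ks : seq nat) (n : nat) : K :=
  if ks is k :: ks' then (\sum_(m < n) mcoef K ks' m) / n%:R ^+ k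
  else (n == 0)%:R.

(** Isolates the largest summation index. Appending is injective, and both sides have the same
    cardinality, so it is a legitimate reindexing. *)
Lemma sum_tuple_rcons (K : numFieldType) (T : finType) (r : nat)
    (P : pred (seq T)) (F : seq T -> K) :
  \sum_(t : r.+1.-tuple T | P t) F t =
  \sum_(t : r.-tuple T) \sum_(x : T | P (rcons t x)) F (rcons t x).
Proof.
pose h (p : r.-tuple T * T) : r.+1.-tuple T := [tuple of rcons p.1 p.2].
have hb : bijective h.
  apply: inj_card_bij.
    move=> [s x] [t y] /(congr1 val) /= /rcons_inj[st ->].
    by congr (_, _); apply: val_inj.
  by rewrite card_prod !card_tuple expnSr.
rewrite (reindex h) /=; last exact: onW_bij.
rewrite pair_big_dep /=; apply: eq_bigl => p /=.
by [].
Qed.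

(** The weight [g] is arbitrary so that the induction from the right can absorb the removed largest
    index into it. Positivity of [N] matters for empty [ks], where the single empty tuple
    contributes [g 0]. *)
Lemma sum_tuple_mcoef (K : numFieldType) (ks : seq nat) (N : nat) (g : nat -> K) :
  (0 < N)%N ->
  \sum_(t : (size ks).-tuple 'I_N | path ltn 0 (map val t))
     (\prod_(i < size ks) (nth 0%N (map val t) i)%:R ^+ nth 0%N ks i)^-1
       * g (last 0%N (map val t)) =
  \sum_(n < N) mcoef K (rev ks) n * g n.
Proof.
move=> N0; elim/last_ind: ks g => [|ks k IH] g.
  rewrite (bigD1 [tuple])//= [X in _ + X]big1 ?addr0; last first.
    by move=> t /andP[_ /eqP[]]; exact: tuple0.
  rewrite big_ord0 invr1 mul1r; case: N N0 => // N _.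
  rewrite big_ord_recl/= mul1r big1 ?addr0// => i _.
  by rewrite mul0r.
rewrite size_rcons (sum_tuple_rcons _ (fun t : seq 'I_N => path ltn 0%N (map val t))
  (fun t : seq 'I_N => (\prod_(i < (size ks).+1)
     (nth 0%N (map val t) i)%:R ^+ nth 0%N (rcons ks k) i)^-1
       * g (last 0%N (map val t)))).
rewrite rev_rcons /=.
(* The new weight: all choices of the removed index lying above the previous one, [m]. *)
pose g' m := \sum_(n < N | (m < n)%N) (n%:R ^+ k)^-1 * g n.
transitivity (\sum_(t : (size ks).-tuple 'I_N | path ltn 0 (map val t))
     (\prod_(i < size ks) (nth 0%N (map val t) i)%:R ^+ nth 0%N ks i)^-1
       * g' (last 0%N (map val t))).
  rewrite [RHS]big_mkcond/=; apply: eq_bigr => t _.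
  have pE x : path ltn 0 (map val (rcons t x)) =
      path ltn 0 (map val t) && (last 0%N (map val t) < val x)%N.
    by rewrite map_rcons rcons_path.
  under eq_bigl do rewrite pE.
  case: ifP => pt /=; last by rewrite big_pred0.
  rewrite /g' mulr_sumr; apply: eq_bigr => x _.
  rewrite map_rcons last_rcons big_ord_recr/= mulrA -invfM; congr (_^-1 * _).
  rewrite !nth_rcons size_map size_tuple ltnn eqxx; congr (_ * _).
  apply: eq_bigr => i _; rewrite !nth_rcons size_map size_tuple.
  by rewrite !ltn_ord.
rewrite IH.
transitivity (\sum_(m < N) \sum_(n < N)
    if (m < n)%N then mcoef K (rev ks) m * (n%:R ^- k * g n) else 0).
  by apply: eq_bigr => m _; rewrite /g' big_distrr /= big_mkcond.
rewrite exchange_big/=; apply: eq_bigr => n _.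
rewrite -big_mkcond/= -mulrA big_distrl /=.
by rewrite (big_ord_widen_cond _ xpredT
  (fun m : nat => mcoef K (rev ks) m * (n%:R ^- k * g n)) (ltnW (ltn_ord n))).
Qed.

Lemma mcoef0 (K : numFieldType) k ks : mcoef K (k :: ks) 0 = 0.
Proof. by rewrite /= big_ord0 mul0r. Qed.

Lemma mcoef_ge0 (K : numFieldType) ks n : 0 <= mcoef K ks n.
Proof.
elim: ks n => [|k ks IH] n /=; first by rewrite ler0n.
by rewrite divr_ge0// ?exprn_ge0// ?ler0n// sumr_ge0.
Qed.

(** At most n terms bounded by 1, divided by n^(k+1) >= n. This crude bound already yields
    convergence on the open unit disc. *)
Lemma mcoef_le1 (K : numFieldType) k ks n :
  (forall m, mcoef K ks m <= 1) -> mcoef K (k.+1 :: ks) n <= 1.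
Proof.
move=> H; case: n => [|n]; first by rewrite mcoef0.
rewrite /= ler_pdivrMr ?exprn_gt0 ?ltr0n// mul1r.
apply: (@le_trans _ _ (\sum_(m < n.+1) 1)); first exact: ler_sum.
rewrite sumr_const card_ord -natrX ler_nat.
by rewrite -{1}(expn1 n.+1) leq_pexp2l.
Qed.

Lemma mcoef_nil_le1 (K : numFieldType) n : mcoef K [::] n <= 1.
Proof. by rewrite /= lern1 leq_b1. Qed.

(** The indicator is needed for k = 0, where [0 ^+ 0] is 1. *)
Lemma mcoef_single (K : numFieldType) k n :
  mcoef K [:: k] n = (0 < n)%:R / n%:R ^+ k.
Proof.
case: n => [|n]; first by rewrite mcoef0 mul0r.
by rewrite /= big_ord_recl/= big1 ?addr0.
Qed.

Lemma mcoef_single_le1 (K : numFieldType) k n : mcoef K [:: k] n <= 1.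
Proof.
case: k => [|k]; last by apply: mcoef_le1 => m; exact: mcoef_nil_le1.
by rewrite mcoef_single expr0 divr1; case: (0 < n)%N.
Qed.

Lemma mcoef_path_le1 (K : numFieldType) ks n :
  all (fun k => 0 < k)%N ks -> mcoef K ks n <= 1.
Proof.
elim: ks n => [|[|k] ks IH] n //= => [_|H]; first exact: mcoef_nil_le1.
by apply: mcoef_le1 => m; exact: IH.
Qed.

Lemma mcoef_cons (K : numFieldType) k ks n :
  mcoef K (k :: ks) n = (\sum_(m < n) mcoef K ks m) / n%:R ^+ k.
Proof. by []. Qed.

Arguments mcoef K ks n : simpl never.

(** * Power series *)

(** q^n is the smallest of the n + 1 terms of a partial geometric sum. The bound absorbs the linear
    factor created by differentiating a power series. *)
Lemma natM_exp_le (R : realType) (q : R) (n : nat) :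
  0 <= q -> q < 1 -> n.+1%:R * q ^+ n <= (1 - q)^-1.
Proof.
move=> q0 q1.
apply: (@le_trans _ _ (\sum_(k < n.+1) q ^+ k)).
  have -> : n.+1%:R * q ^+ n = \sum_(k < n.+1) q ^+ n.
    by rewrite sumr_const card_ord mulr_natl.
  apply: ler_sum => k _.
  by apply: ler_wiXn2l; rewrite ?(ltW q1)// -ltnS.
rewrite -[leRHS]mul1r ler_pdivlMr ?subr_gt0// mulrC.
by rewrite -(opprB q 1) mulNr -subrX1 opprB lerBlDr lerDl exprn_ge0.
Qed.

Lemma is_cvg_pseries_diffs (R : realType) (f : nat -> R) (x z : R) :
  cvgn (pseries f x) -> `|z| < `|x| -> cvgn (pseries (pseries_diffs f) z).
Proof.
move=> cx zx; pose y := (`|z| + `|x|) / 2.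
have zy : `|z| < y by rewrite /y; lra.
have y0 : 0 < y by apply: le_lt_trans zy.
have yx : `|y| < `|x| by rewrite gtr0_norm// /y; lra.
have := is_cvg_pseries_inside_norm cx yx.
pose q := `|z| / y.
have q0 : 0 <= q by rewrite divr_ge0// ltW.
have q1 : q < 1 by rewrite ltr_pdivrMr// mul1r.
rewrite /pseries -(cvg_shiftS (series _)) => /cvgP cy.
apply: normed_cvg.
have yn : y != 0 by rewrite lt0r_neq0.
have qn : 1 - q != 0 by rewrite subr_eq0 gt_eqF.
(* The factor (1 - q)^-1 bounds (n+1) (|z|/y)^n; the division by y matches y^n with the term of
   index n + 1 in the series at y. *)
pose C := (1 - q)^-1 / y.
have C0 : 0 <= C by rewrite divr_ge0 ?invr_ge0 ?subr_ge0 ?(ltW q1)// ltW.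
apply: (@series_le_cvg _ _ (fun n => C * (`|f n.+1| * y ^+ n.+1))) => [n|n|n|].
- exact: normr_ge0.
- by rewrite mulr_ge0// mulr_ge0// exprn_ge0// ltW.
- rewrite /pseries_diffs /= !normrM normr_nat normrX.
  have -> : C * (`|f n.+1| * y ^+ n.+1) = `|f n.+1| * y ^+ n * (1 - q)^-1.
    by rewrite /C exprS; field; rewrite yn qn.
  have -> : n.+1%:R * `|f n.+1| * `|z| ^+ n =
      `|f n.+1| * y ^+ n * (n.+1%:R * q ^+ n).
    have -> : `|z| ^+ n = q ^+ n * y ^+ n by rewrite -exprMn divfK.
    ring.
  by rewrite ler_wpM2l ?natM_exp_le// mulr_ge0// exprn_ge0// ltW.
have -> : series (fun n => C * (`|f n.+1| * y ^+ n.+1)) =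
   fun N => C * (series (fun i => `|f i| * y ^+ i) N.+1 - `|f 0%N|).
  apply/funext => N; rewrite /series/= -mulr_sumr; congr (_ * _).
  by rewrite big_nat_recl//= expr0 mulr1 addrC addrA addNr add0r.
apply: is_cvgM; first exact: is_cvg_cst.
by apply: is_cvgB; [exact: cy | exact: is_cvg_cst].
Qed.

Lemma is_cvg_pseries_bounded (R : realType) (f : nat -> R) (x : R) :
  (forall n, 0 <= f n <= 1) -> `|x| < 1 -> cvgn (pseries f x).
Proof.
move=> f01 x1; apply: normed_cvg.
apply: (@series_le_cvg _ _ (geometric 1 `|x|)) => [n|n|n|].
- exact: normr_ge0.
- by rewrite /= mul1r exprn_ge0.
- have /andP[f0 f1] := f01 n.
  by rewrite /= normrM normrX (ger0_norm f0) /= ler_wpM2r// exprn_ge0.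
- by apply: is_cvg_geometric_series; rewrite normr_id.
Qed.

Lemma is_derive_pseries (R : realType) (f : nat -> R) (x : R) :
  (forall n, 0 <= f n <= 1) -> `|x| < 1 ->
  is_derive x (1 : R) (fun x => limn (pseries f x))
    (limn (pseries (pseries_diffs f) x)).
Proof.
move=> f01 x1.
(* Each formal derivative costs a little of the radius: the series converges at c, its first
   derivative at b, its second at a, and a still exceeds |x|. *)
pose a := (1 + `|x|) / 2; pose b := (1 + a) / 2; pose c := (1 + b) / 2.
have ax : `|x| < a by rewrite /a; lra.
have a1 : a < 1 by rewrite /a; lra.
have ab : a < b by rewrite /b; lra.
have b1 : b < 1 by rewrite /b; lra.
have bc : b < c by rewrite /c; lra.
have c1 : c < 1 by rewrite /c; lra.
have a0 : 0 <= a by apply: le_trans (ltW ax).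
have b0 : 0 <= b by apply: le_trans (ltW ab).
have c0 : 0 <= c by apply: le_trans (ltW bc).
have H1 : cvgn (pseries f c) by apply: is_cvg_pseries_bounded; rewrite ?ger0_norm.
have H2 : cvgn (pseries (pseries_diffs f) b).
  by apply: is_cvg_pseries_diffs H1 _; rewrite !ger0_norm.
have H3 : cvgn (pseries (pseries_diffs (pseries_diffs f)) a).
  by apply: is_cvg_pseries_diffs H2 _; rewrite !ger0_norm.
apply: (pseries_snd_diffs _ _ H3); last by rewrite (ger0_norm a0).
- by apply: is_cvg_pseries_inside H1 _; rewrite !ger0_norm// (lt_trans ab).
- by apply: is_cvg_pseries_inside H2 _; rewrite !ger0_norm.
Qed.

(* Abel: multiplication by 1 / (1 - x) takes partial sums of the coefficients. *)
Lemma cvg_pseries_sum (R : realType) (f : nat -> R) (x : R) :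
  (forall n, 0 <= f n <= 1) -> `|x| < 1 ->
  pseries (fun n => \sum_(m < n.+1) f m) x @ \oo -->
    limn (pseries f x) / (1 - x).
Proof.
move=> f01 x1.
have x1' : 1 - x != 0 by rewrite subr_eq0 gt_eqF// (le_lt_trans (ler_norm _)).
(* Summation by parts at finite [N]; only the boundary term has to be shown to vanish. *)
have E N : pseries (fun n => \sum_(m < n.+1) f m) x N =
    (pseries f x N - (\sum_(m < N) f m) * x ^+ N) / (1 - x).
  apply: (mulIf x1'); rewrite mulfVK//.
  elim: N => [|N IH]; first by rewrite /pseries /series/= !big_geq// big_ord0 !mul0r subrr.
  rewrite /pseries /series/= in IH *.
  rewrite !big_nat_recr//= mulrDl IH big_ord_recr/= exprS; ring.
rewrite (funext E); apply: cvgM; last exact: cvg_cst.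
rewrite -[X in _ --> X]subr0; apply: cvgB; first exact: is_cvg_pseries_bounded.
apply: norm_cvg0.
pose y := (1 + `|x|) / 2.
have y1 : y < 1 by rewrite /y; lra.
have xy : `|x| < y by rewrite /y; lra.
have y0 : 0 <= y by apply: le_trans (ltW xy).
(* The terms (n+1)|x|^n of this convergent series tend to 0 and dominate the boundary term, whose
   coefficient sum is at most n. *)
have /cvg_series_cvg_0 C : cvgn (pseries (pseries_diffs (fun=> 1 : R)) `|x|).
  apply: (@is_cvg_pseries_diffs _ _ y); last by rewrite normr_id (ger0_norm y0).
  by apply: is_cvg_pseries_bounded => [n|]; rewrite ?ler01 ?lexx ?(ger0_norm y0).
apply: (squeeze_cvgr _ _ C); last exact: cvg_cst.
near=> n; rewrite normr_ge0/= normrM normrX ler_wpM2r ?exprn_ge0//.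
rewrite /pseries_diffs mulr1 ger0_norm; last first.
  by apply: sumr_ge0 => i _; have /andP[] := f01 i.
apply: (@le_trans _ _ (\sum_(m < n) 1)).
  by apply: ler_sum => i _; have /andP[] := f01 i.
by rewrite sumr_const card_ord ler_nat.
Unshelve. all: by end_near. Qed.

Lemma pseries_at0 (R : realType) (f : nat -> R) : limn (pseries f 0) = f 0%N.
Proof.
apply: cvg_lim => //; rewrite -(cvg_shiftS (pseries f 0)).
have -> : [sequence pseries f 0 n.+1]_n = cst (f 0%N); last exact: cvg_cst.
apply/funext => n; rewrite /pseries /series/= big_nat_recl//= big1 ?expr0 ?mulr1 ?addr0//.
by move=> i _; rewrite expr0n mulr0.
Qed.

(** * Polylogarithms *)

(** [lim] chooses from the set of limits, and that set ignores the term of index 0. In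
    [multisum_mcoef] this disposes of N = 0, where the empty tuple and the empty sum disagree. *)
Lemma limn_shift_eq (V : ptopologicalType) (u v : nat -> V) :
  (forall n, u n.+1 = v n.+1) -> limn u = limn v.
Proof.
move=> uv; rewrite /lim /lim_in; congr get; apply/funext => l.
rewrite -(cvg_shiftS u) -(cvg_shiftS v).
by congr (_ @ \oo --> l); apply/funext => n; exact: uv.
Qed.

Lemma multisum_mcoef (K : numFieldType) (ks : seq nat) (g : nat -> K) :
  multisum (size ks) (fun n =>
    (\prod_(i < size ks) (nth 0%N n i)%:R ^+ nth 0%N ks i)^-1 * g (last 0%N n)) =
  limn (fun N => \sum_(0 <= n < N) mcoef K (rev ks) n * g n).
Proof.
by apply: limn_shift_eq => N; rewrite sum_tuple_mcoef// big_mkord.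
Qed.

Definition polylog (R : realType) (ks : seq nat) (x : R) : R :=
  limn (pseries (mcoef R ks) x).

Lemma LiE (R : realType) (ks : seq nat) (x : R) : Li ks x = polylog (rev ks) x.
Proof.
rewrite /Li /polylog /pseries /series /= -(multisum_mcoef _ (fun n => x ^+ n)).
by congr multisum; apply/funext => n; rewrite mulrC.
Qed.

Lemma mcoef01 (R : realType) ks :
  (forall n, mcoef R ks n <= 1) -> forall n, 0 <= mcoef R ks n <= 1.
Proof. by move=> H n; rewrite mcoef_ge0 H. Qed.

Lemma polylog_nil (R : realType) (x : R) : polylog [::] x = 1.
Proof.
apply: cvg_lim => //; rewrite -(cvg_shiftS (pseries _ x)).
have -> : [sequence pseries (mcoef R [::]) x n.+1]_n = cst 1; last exact: cvg_cst.
apply/funext => n; rewrite /pseries /series/= big_nat_recl//= big1 ?expr0 ?mulr1 ?addr0//.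
by move=> i _; rewrite mul0r.
Qed.

(** The coefficient form of x d/dx, which lowers the exponent of the largest index. *)
Lemma mcoef_sum_lin (R : realType) k ks n :
  n.+1%:R * mcoef R (k.+1 :: ks) n.+1 = mcoef R (k :: ks) n.+1.
Proof.
by rewrite !mcoef_cons exprS invfM mulrCA mulrA -mulrA mulVKf.
Qed.

Lemma is_derive_polylog1 (R : realType) ks (x : R) :
  (forall n, mcoef R ks n <= 1) -> `|x| < 1 ->
  is_derive x (1 : R) (polylog (1%N :: ks)) (polylog ks x / (1 - x)).
Proof.
move=> H x1; apply: is_derive_eq.
  by apply: is_derive_pseries => //; apply: mcoef01 => n; exact: mcoef_le1.
have -> : pseries_diffs (mcoef R (1%N :: ks)) =
    fun n => \sum_(m < n.+1) mcoef R ks m.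
  apply/funext => n; rewrite /pseries_diffs mcoef_sum_lin.
  by rewrite mcoef_cons expr0 divr1.
by apply: cvg_lim => //; apply: cvg_pseries_sum => //; exact: mcoef01.
Qed.

Lemma is_derive_polylogS (R : realType) k ks (x : R) :
  (forall n, mcoef R (k :: ks) n <= 1) ->
  (forall n, mcoef R (k.+1 :: ks) n <= 1) -> `|x| < 1 -> x != 0 ->
  is_derive x (1 : R) (polylog (k.+1 :: ks)) (polylog (k :: ks) x / x).
Proof.
move=> H H1 x1 x0; apply: is_derive_eq.
  by apply: is_derive_pseries => //; exact: mcoef01.
have E : pseries_diffs (mcoef R (k.+1 :: ks)) =
    fun n => mcoef R (k :: ks) n.+1.
  by apply/funext => n; rewrite /pseries_diffs mcoef_sum_lin.
apply: cvg_lim => //; rewrite E.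
have -> : pseries (fun n => mcoef R (k :: ks) n.+1) x =
   fun N => pseries (mcoef R (k :: ks)) x N.+1 / x.
  apply/funext => N; rewrite /pseries /series /= big_nat_recl// mcoef0 mul0r add0r.
  by rewrite mulr_suml; apply: eq_bigr => i _; rewrite exprS mulrCA [RHS]mulrC mulKf.
apply: cvgM; last exact: cvg_cst.
rewrite (cvg_shiftS (pseries _ x)); apply: is_cvg_pseries_bounded => //.
exact: mcoef01.
Qed.

Lemma expRN_lt1 (R : realType) (t : R) : 0 < t -> `|expR (- t)| < 1.
Proof. by move=> t0; rewrite ger0_norm ?expR_ge0// expR_lt1 oppr_lt0. Qed.

Lemma onem_expRN_lt1 (R : realType) (t : R) : 0 <= t -> `|1 - expR (- t)| < 1.
Proof.
move=> t0; have := expR_gt0 (- t).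
have : expR (- t) <= 1 by rewrite -[leRHS]expR0 ler_expR oppr_le0.
by move=> ? ?; rewrite ger0_norm ?subr_ge0//; lra.
Qed.

Lemma is_derive_expRN (R : realType) (t : R) :
  is_derive t (1 : R) (fun t => expR (- t)) (- expR (- t)).
Proof.
have := is_derive1_comp (is_derive_expR (- t)) (is_deriveNid t (1 : R)).
by rewrite mulrN1.
Qed.

Lemma is_derive_onem_expRN (R : realType) (t : R) :
  is_derive t (1 : R) (fun t => 1 - expR (- t)) (expR (- t)).
Proof.
have := is_deriveB (is_derive_cst (1 : R) t (1 : R)) (is_derive_expRN t).
by rewrite sub0r opprK.
Qed.

(** At x = 1 - e^-t the factor 1 / (1 - x) is e^t and cancels x' = e^-t, so a leading 1 is simply
    removed. *)
Lemma is_derive_polylog1_onem (R : realType) ks (t : R) :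
  (forall n, mcoef R ks n <= 1) -> 0 <= t ->
  is_derive t (1 : R) (fun t => polylog (1%N :: ks) (1 - expR (- t)))
    (polylog ks (1 - expR (- t))).
Proof.
move=> H t0; have zt := onem_expRN_lt1 t0.
have := @is_derive1_comp _ _ (fun t => 1 - expR (- t)) _ _ _
  (is_derive_polylog1 H zt) (is_derive_onem_expRN t).
by rewrite subKr divfK// gt_eqF// expR_gt0.
Qed.

(** Here x' / x = e^-t / (1 - e^-t) = 1 / (e^t - 1). *)
Lemma is_derive_polylog2_onem (R : realType) ks (t : R) :
  (forall n, mcoef R ks n <= 1) -> 0 < t ->
  is_derive t (1 : R) (fun t => polylog (2%N :: ks) (1 - expR (- t)))
    (polylog (1%N :: ks) (1 - expR (- t)) / (expR t - 1)).
Proof.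
move=> H t0; have zt := onem_expRN_lt1 (ltW t0).
have H1 n : mcoef R (1%N :: ks) n <= 1 by exact: mcoef_le1.
have H2 n : mcoef R (2%N :: ks) n <= 1 by exact: mcoef_le1.
have e1 : 1 - expR (- t) != 0.
  by rewrite subr_eq0 gt_eqF// expR_lt1 oppr_lt0.
have e2 : expR t - 1 != 0 by rewrite subr_eq0 gt_eqF// expR_gt1.
have := @is_derive1_comp _ _ (fun t => 1 - expR (- t)) _ _ _
  (is_derive_polylogS H1 H2 zt e1) (is_derive_onem_expRN t).
congr is_derive; rewrite -mulrA; congr (_ * _).
apply: (mulfI e1); rewrite mulVKf//; apply: (mulIf e2); rewrite mulfVK//.
by rewrite mulrBr mulr1 -expRD addNr expR0.
Qed.

Lemma is_derive_polylog_expRN (R : realType) k (t : R) : 0 < t ->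
  is_derive t (1 : R) (fun t => polylog [:: k.+1] (expR (- t)))
    (- polylog [:: k] (expR (- t))).
Proof.
move=> t0; have xt := expRN_lt1 t0.
have e0 : expR (- t) != 0 by rewrite gt_eqF ?expR_gt0.
have := @is_derive1_comp _ _ (fun t => expR (- t)) _ _ _
  (is_derive_polylogS (@mcoef_single_le1 R k) (@mcoef_single_le1 R k.+1) xt e0)
  (is_derive_expRN t).
by rewrite mulrN divfK.
Qed.

(** Li_0(x) = x / (1 - x): up to a shift by one index, the coefficients are the partial sums of
    those of the constant 1. *)
Lemma polylog_single0 (R : realType) (t : R) : 0 < t ->
  polylog [:: 0%N] (expR (- t)) = (expR t - 1)^-1.
Proof.
move=> t0; have xt := expRN_lt1 t0.
have e2 : expR t - 1 != 0 by rewrite subr_eq0 gt_eqF// expR_gt1.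
have e1 : 1 - expR (- t) != 0.
  by rewrite subr_eq0 gt_eqF// expR_lt1 oppr_lt0.
apply: cvg_lim => //; rewrite -(cvg_shiftS (pseries _ _)).
have -> : [sequence pseries (mcoef R [:: 0%N]) (expR (- t)) n.+1]_n =
    fun N => expR (- t) * pseries (fun n => \sum_(m < n.+1) mcoef R [::] m) (expR (- t)) N.
  apply/funext => N; rewrite /pseries /series /= big_nat_recl// mcoef0 mul0r add0r.
  rewrite mulr_sumr; apply: eq_bigr => i _; rewrite mcoef_cons expr0 divr1 exprS.
  by rewrite mulrCA.
have -> : (expR t - 1)^-1 = expR (- t) * (polylog [::] (expR (- t)) / (1 - expR (- t))).
  rewrite polylog_nil mul1r; apply: (mulIf e1); rewrite mulfVK//.
  apply: (mulfI e2); rewrite mulVKf// mulrBl -expRD subrr expR0; ring.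
apply: cvgM; first exact: cvg_cst.
by apply: cvg_pseries_sum => //; apply: mcoef01 => n; exact: mcoef_nil_le1.
Qed.

(** By the mean value theorem [h] is constant on ]0, t], so its right limit is its value at [t]. A
    limit replaces an initial value because Li_1(e^-t) is singular at 0. *)
Lemma eq0_derive0_right (R : realType) (h : R -> R) (t : R) :
  (forall u : R, 0 < u -> is_derive u (1 : R) h 0) ->
  h u @[u --> 0^'+] --> (0 : R) -> 0 < t -> h t = 0.
Proof.
move=> dh h0 t0.
have hc u : 0 < u -> u <= t -> h u = h t.
  move=> u0; rewrite le_eqVlt => /predU1P[->//|ut].
  have [| |c _] := @MVT _ h (fun=> 0) u t ut.
  - by move=> x; rewrite in_itv/= => /andP[ux _]; apply: dh; exact: lt_trans ux.
  - apply: derivable_within_continuous => x; rewrite in_itv/= => /andP[ux _].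
    by have [] := dh x (lt_le_trans u0 ux).
  - by rewrite mul0r => /eqP; rewrite subr_eq0 => /eqP.
apply/esym; apply: (cvg_unique _ h0) => //.
apply: cvg_near_cst; near=> u; apply: hc => //.
near: u; exact: nbhs_right_le.
Unshelve. all: by end_near. Qed.

Lemma is_derive_sumf (R : realType) n (h : 'I_n -> R -> R) (x : R) (dh : 'I_n -> R) :
  (forall i, is_derive x (1 : R) (h i) (dh i)) ->
  is_derive x (1 : R) (fun t => \sum_(i < n) h i t) (\sum_(i < n) dh i).
Proof.
move=> H; have -> : (fun t => \sum_(i < n) h i t) = \sum_(i < n) h i.
  by rewrite fct_sumE.
exact: is_derive_sum.
Qed.

(* [dpow n.+1 t = t ^+ n / n`!]; the shift makes [dpow n] the derivative of
   [dpow n.+1] also when [n = 0]. *)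
Definition dpow (R : realType) (n : nat) (t : R) : R :=
  if n is k.+1 then t ^+ k / k`!%:R else 0.

Lemma is_derive_dpow (R : realType) n (t : R) :
  is_derive t (1 : R) (dpow n.+1) (dpow n t).
Proof.
case: n => [|n].
  have -> : dpow 1 = cst (1 : R) by apply/funext => x; rewrite /dpow/= expr0 divr1.
  exact: is_derive_cst.
have D : is_derive t (1 : R) (fun x => x ^+ n.+1) (n.+1%:R * t ^+ n).
  apply: DeriveDef; first exact: exprn_derivable.
  by rewrite exp_derive; rewrite /GRing.scale /= mulr1.
have -> : dpow n.+2 = (n.+1`!%:R)^-1 \*: (fun x : R => x ^+ n.+1).
  by apply/funext => x; rewrite /dpow mulrC.
apply: (is_derive_eq (is_deriveZ _ D)).
rewrite /dpow /GRing.scale /= factS natrM invfM [LHS]mulrC -mulrA.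
by rewrite mulrCA [X in _ * X]mulrA mulfV ?pnatr_eq0// mul1r.
Qed.

Lemma dpow0 (R : realType) (t : R) : dpow 0 t = 0. Proof. by []. Qed.

Lemma dpow1 (R : realType) (t : R) : dpow 1 t = 1.
Proof. by rewrite /dpow expr0 divr1. Qed.

Lemma dpowSS (R : realType) n (t : R) : dpow n.+2 t = t * (t ^+ n / n.+1`!%:R).
Proof. by rewrite /dpow exprS mulrA. Qed.

Arguments dpow R n t : simpl never.

(** * Derivatives of the two sums in the closed formula *)

Section polylog_formula.
Variable R : realType.
Implicit Types t : R.

Definition zetaR (k : nat) : R := limn (series (mcoef R [:: k])).

Definition Liexp (l : nat) t : R := polylog [:: l] (expR (- t)).

(** Precursor of the double zeta sum: with m = r - j and l = m + q one has j - q = r - l, and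
    integration will turn the q-th term into the one with zeta(l + 1, s + r - l). *)
Definition tailsum (j m : nat) t : R := \sum_(q < j.+1)
  'C(m + q, m)%:R * (dpow (j - q).+1 t * Liexp (m + q).+1 t).

Definition zetasum (j m : nat) t : R := \sum_(i < m.+1)
  ((-1) ^+ i * 'C(i + j, i)%:R * zetaR (i + j + 1)) * dpow (m - i).+1 t.

Let tailsum_derive_expr j m t := \sum_(q < j.+1) 'C(m + q, m)%:R *
  (dpow (j - q).+1 t * (- Liexp (m + q) t) + Liexp (m + q).+1 t * dpow (j - q) t).

Let is_derive_tailsum_expr j m t : 0 < t ->
  is_derive t (1 : R) (tailsum j m) (tailsum_derive_expr j m t).
Proof.
move=> t0; apply: is_derive_sumf => q.
apply: is_deriveZ; apply: is_deriveM; first exact: is_derive_dpow.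
exact: is_derive_polylog_expRN.
Qed.

(** Differentiating Li at q + 1 and the power at q gives the same product. Shifting one family by
    one index collects these into a difference of binomials; the term q = 0 of the first family
    stays over, and the term q = j of the second contains [dpow 0]. *)
Let tailsum_derive_exprE j m t : tailsum_derive_expr j m t =
  \sum_(q < j) (('C(m + q, m)%:R - 'C(m + q.+1, m)%:R)
     * (dpow (j - q) t * Liexp (m + q).+1 t)) - dpow j.+1 t * Liexp m t.
Proof.
rewrite /tailsum_derive_expr.
under eq_bigr do rewrite mulrDr.
rewrite big_split /= big_ord_recl big_ord_recr /=.
rewrite subn0 addn0 binn mul1r subnn dpow0 !mulr0 addr0.
rewrite -addrA [RHS]addrC mulrN; congr (_ + _).
rewrite -big_split /=; apply: eq_bigr => q _.
by rewrite /bump /= add1n !addnS subnSK//; ring.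
Qed.

(** For m = 0 all binomials are 1, so the differences vanish and only the leftover term remains. *)
Lemma is_derive_tailsum0 j t : 0 < t ->
  is_derive t (1 : R) (tailsum j 0) (- (dpow j.+1 t * Liexp 0 t)).
Proof.
move=> t0; apply: (is_derive_eq (is_derive_tailsum_expr j 0 t0)).
rewrite tailsum_derive_exprE big1 ?sub0r// => q _.
by rewrite !bin0 subrr mul0r.
Qed.

(** By Pascal's rule each difference of binomials is minus a binomial with lower index m; the
    leftover term provides the summand q = 0. *)
Lemma is_derive_tailsumS j m t : 0 < t ->
  is_derive t (1 : R) (tailsum j m.+1) (- tailsum j m t).
Proof.
move=> t0; apply: (is_derive_eq (is_derive_tailsum_expr j m.+1 t0)).
rewrite tailsum_derive_exprE /tailsum big_ord_recl /= subn0 addn0 binn mul1r.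
rewrite opprD addrC; congr (_ + _).
rewrite -sumrN; apply: eq_bigr => q _.
rewrite /bump /= add1n subnSK// !addSn !addnS (binS (m + q).+1 m) natrD; ring.
Qed.

Lemma is_derive_zetasum0 j t : is_derive t (1 : R) (zetasum j 0) 0.
Proof.
have -> : 0 = \sum_(i < 1) ((-1) ^+ i * 'C(i + j, i)%:R * zetaR (i + j + 1)) * dpow (0 - i) t.
  by rewrite big_ord1 sub0n dpow0 mulr0.
by apply: is_derive_sumf => i; apply: is_deriveZ; exact: is_derive_dpow.
Qed.

Lemma is_derive_zetasumS j m t : is_derive t (1 : R) (zetasum j m.+1) (zetasum j m t).
Proof.
have -> : zetasum j m t = \sum_(i < m.+2)
    ((-1) ^+ i * 'C(i + j, i)%:R * zetaR (i + j + 1)) * dpow (m.+1 - i) t.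
  rewrite [RHS]big_ord_recr /= subnn dpow0 mulr0 addr0.
  by apply: eq_bigr => i _; rewrite subSn// -ltnS.
by apply: is_derive_sumf => i; apply: is_deriveZ; exact: is_derive_dpow.
Qed.

End polylog_formula.

(** * Boundary behaviour of polylogarithms *)

(** A telescoping substitute for the integral test. After factoring out (n+2)^(1-s) it follows from
    e^x >= 1 + x and ln(1 - 1/(n+2)) <= -1/(n+2). *)
Lemma riemannR_le (R : realType) (s : R) n : 1 < s ->
  (s - 1) * riemannR s n.+1 <= n.+1%:R `^ (1 - s) - n.+2%:R `^ (1 - s).
Proof.
move=> s1; rewrite /riemannR.
have p0 : (0 : R) < n.+2%:R by [].
have q0 : (0 : R) < n.+1%:R by [].
have -> : (n.+2%:R `^ s)^-1 = n.+2%:R `^ (1 - s) / n.+2%:R.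
  have -> : 1 - s = - s + 1 by rewrite addrC.
  by rewrite powRD ?pnatr_eq0 ?implybT// powRr1// mulfK ?pnatr_eq0// powRN.
have -> : n.+1%:R `^ (1 - s) = n.+2%:R `^ (1 - s) * (n.+1%:R / n.+2%:R) `^ (1 - s) :> R.
  by rewrite -powRM// ?divr_ge0// mulrC divfK// gt_eqF.
rewrite mulrCA -[X in _ <= _ - X]mulr1 -mulrBr ler_wpM2l ?powR_ge0//.
rewrite /powR gt_eqF ?divr_gt0//.
apply: le_trans (lerB (expR_ge1Dx _) (lexx 1)).
rewrite addrAC subrr add0r.
rewrite -[leRHS]mulrNN opprB ler_wpM2l ?subr_ge0 ?(ltW s1)//.
have -> : n.+1%:R / n.+2%:R = 1 + (- n.+2%:R^-1) :> R.
  apply: (mulIf (lt0r_neq0 p0)); rewrite divfK ?gt_eqF//.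
  by rewrite mulrDl mulNr mulVf ?gt_eqF// mul1r -(natr1 n.+1) addrK.
rewrite lerNr; apply: le_ln1Dx.
by rewrite ltrN2 invf_lt1// ltr1n.
Qed.

Lemma is_cvg_riemannR (R : realType) (s : R) : 1 < s -> cvgn (series (riemannR s)).
Proof.
move=> s1; have s0 : 0 < s - 1 by rewrite subr_gt0.
have B N : \sum_(0 <= n < N) riemannR s n.+1 <=
    (1 - N.+1%:R `^ (1 - s)) / (s - 1).
  elim: N => [|N IH]; first by rewrite big_geq// powR1 subrr mul0r.
  rewrite big_nat_recr//=; apply: le_trans (lerD IH (lexx _)) _.
  rewrite -lerBrDl -mulrBl ler_pdivlMr// mulrC.
  apply: le_trans (riemannR_le _ s1) _; lra.
apply: nondecreasing_is_cvgn.
  by apply: nondecreasing_series => n _ _; rewrite /riemannR invr_ge0 powR_ge0.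
exists (1 + (s - 1)^-1) => _ [[|N] _ <-].
  by rewrite /series/= big_geq// addr_ge0// invr_ge0 ltW.
have r0 : riemannR s 0 = 1 by rewrite /riemannR powR1 invr1.
rewrite /series/= big_nat_recl//= -/(riemannR s 0) r0 lerD2l.
apply: le_trans (B N) _; by rewrite -[leRHS]mul1r ler_wpM2r ?invr_ge0 ?(ltW s0)//.
Qed.

Lemma is_cvg_series_mcoef_single (R : realType) k :
  cvgn (series (mcoef R [:: k.+2])).
Proof.
have c2 : cvgn (series (riemannR (2 : R))) by apply: is_cvg_riemannR; rewrite ltr1n.
have : cvgn (series (fun n => mcoef R [:: k.+2] n.+1)).
  apply: series_le_cvg c2 => n; [exact: mcoef_ge0|by rewrite /riemannR invr_ge0 powR_ge0|].
  rewrite mcoef_single /riemannR mul1r powR_mulrn// lef_pV2 ?posrE ?exprn_gt0//.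
  by rewrite -!natrX ler_nat leq_pexp2l.
move=> C; apply/cvg_ex; exists (limn (series (fun n => mcoef R [:: k.+2] n.+1))).
rewrite -(cvg_shiftS (series _)).
have -> // : [sequence series (mcoef R [:: k.+2]) n.+1]_n =
    series (fun n => mcoef R [:: k.+2] n.+1).
by apply/funext => n; rewrite /series /= big_nat_recl// mcoef0 add0r.
Qed.

Lemma pseries_le_limn (R : realType) (f : nat -> R) (x : R) N :
  (forall n, 0 <= f n <= 1) -> 0 <= x -> x < 1 ->
  pseries f x N <= limn (pseries f x).
Proof.
move=> f01 x0 x1; apply: nondecreasing_cvgn_le.
  apply: nondecreasing_series => n _ _.
  by rewrite mulr_ge0 ?exprn_ge0//; have /andP[] := f01 n.
by apply: is_cvg_pseries_bounded => //; rewrite ger0_norm.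
Qed.

Lemma limn_pseries_ge0 (R : realType) (f : nat -> R) (x : R) :
  (forall n, 0 <= f n <= 1) -> 0 <= x -> x < 1 -> 0 <= limn (pseries f x).
Proof.
move=> f01 x0 x1; have := pseries_le_limn 0 f01 x0 x1.
by rewrite /pseries /series /= big_geq.
Qed.

(** The first [N] terms contribute at most 1 each, the others at most e / (1 - x) together. Hence
    coefficients tending to 0 make the sum o(1 / (1 - x)) as x tends to 1. *)
Lemma limn_pseries_onem_le (R : realType) (f : nat -> R) (x e : R) N :
  (forall n, 0 <= f n <= 1) -> 0 <= x -> x < 1 ->
  (forall n, (N <= n)%N -> f n <= e) -> 0 <= e ->
  limn (pseries f x) * (1 - x) <= N%:R * (1 - x) + e.
Proof.
move=> f01 x0 x1 fe e0.
have x1' : 0 < 1 - x by rewrite subr_gt0.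
rewrite -ler_pdivlMr// mulrDl mulfK ?gt_eqF//.
apply: limr_le; first by apply: is_cvg_pseries_bounded => //; rewrite ger0_norm.
near=> M; apply: (@le_trans _ _ (\sum_(0 <= n < M) ((n < N)%:R + e * x ^+ n))).
  apply: ler_sum => n _; case: ltnP => nN.
    apply: (@le_trans _ _ 1); last by rewrite lerDl mulr_ge0// exprn_ge0.
    have /andP[f0 f1] := f01 n.
    by rewrite -[leRHS]mulr1 ler_pM ?exprn_ge0// exprn_ile1// ltW.
  by rewrite add0r ler_wpM2r ?exprn_ge0// fe.
rewrite big_split/= lerD//.
  rewrite -natr_sum ler_nat big_mkord.
  rewrite -(big_mkcond (fun i : 'I_M => (i < N)%N) (fun=> 1%N)) sum1_card.
  rewrite -[leqRHS]card_ord.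
  have [MN|NM] := leqP M N.
    by apply: leq_trans (max_card _) _; rewrite !card_ord.
  rewrite (_ : #|_| = #|'I_N|)//.
  rewrite -!sum1_card.
  exact: (esym (big_ord_widen_cond _ xpredT (fun=> 1%N) (ltnW NM))).
rewrite -mulr_sumr ler_wpM2l//.
rewrite -[leRHS]mul1r ler_pdivlMr// mulrC big_mkord -(opprB x 1) mulNr -subrX1 opprB.
by rewrite lerBlDr lerDl exprn_ge0.
Unshelve. all: by end_near. Qed.

Lemma cvg_sumr (K : numFieldType) (T : Type) (F : set_system T) (FF : Filter F)
    (I : Type) (r : seq I) (f : I -> T -> K) (l : I -> K) :
  (forall i, f i x @[x --> F] --> l i) ->
  \sum_(i <- r) f i x @[x --> F] --> \sum_(i <- r) l i.
Proof.
move=> H; elim: r => [|i r IH].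
  by rewrite big_nil; under eq_fun do rewrite big_nil; exact: cvg_cst.
by rewrite big_cons; under eq_fun do rewrite big_cons; exact: cvgD.
Qed.

Lemma cvg_exprn (K : numFieldType) (T : Type) (F : set_system T) (FF : Filter F)
    (f : T -> K) (l : K) n :
  f x @[x --> F] --> l -> f x ^+ n @[x --> F] --> l ^+ n.
Proof.
move=> H; elim: n => [|n IH].
  by rewrite expr0; under eq_fun do rewrite expr0; exact: cvg_cst.
by rewrite exprS; under eq_fun do rewrite exprS; exact: cvgM.
Qed.

Section right_limits_at_0.
Variable R : realType.
Implicit Types t : R.

Lemma cvg_right0_of_derive (f : R -> R) (df : R) :
  is_derive 0 (1 : R) f df -> f u @[u --> 0^'+] --> f 0.
Proof.
move=> [/derivable1_diffP/differentiable_continuous fc _].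
exact/cvg_at_right_filter.
Qed.

Lemma cvg_Liexp_mul k : t * Liexp k.+1 t @[t --> (0 : R)^'+] --> (0 : R).
Proof.
apply/cvgrPdist_le => /= e e0.
(* Beyond this index the coefficients are at most e/4. For small t also N (1 - e^-t) <= e/4, so (1 -
   e^-t) Li <= e/2, and t <= 2 (1 - e^-t) gives the bound e. *)
pose N := (Num.trunc (4 / e)).+1.
have Ne : 4 / e <= N%:R by rewrite ltW// truncnS_gt.
have N0 : (0 : R) < N%:R by [].
have f01 := mcoef01 (@mcoef_single_le1 R k.+1).
have fe n : (N <= n)%N -> mcoef R [:: k.+1] n <= e / 4.
  case: n => // n Nn.
  rewrite mcoef_single mul1r -[leRHS]invrK lef_pV2 ?posrE ?exprn_gt0 ?invr_gt0 ?divr_gt0//.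
  rewrite invf_div (le_trans Ne)// -natrX ler_nat (leq_trans Nn)//.
  by rewrite -{1}(expn1 n.+1) leq_pexp2l.
near=> t; rewrite sub0r normrN.
have t0 : 0 < t by near: t; exact: nbhs_right_gt.
have t1 : t < 1 by near: t; exact: nbhs_right_lt.
have tN : t < e / 4 / N%:R by near: t; apply: nbhs_right_lt; rewrite !divr_gt0.
have x0 : 0 <= expR (- t) by exact: expR_ge0.
have x1 : expR (- t) < 1 by rewrite expR_lt1 oppr_lt0.
have P0 : 0 <= Liexp k.+1 t by exact: limn_pseries_ge0.
rewrite ger0_norm ?mulr_ge0 ?(ltW t0)//.
have H := limn_pseries_onem_le f01 x0 x1 fe (ltW (divr_gt0 e0 (ltr0n _ 4))).
rewrite -/(polylog _ _) -/(Liexp _ _) in H.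
have onem_le : 1 - expR (- t) <= t.
  by rewrite lerBlDl -lerBlDr; have := expR_ge1Dx (- t).
(* From e^t >= 1 + t one gets 1 - e^-t >= t / (1 + t), and t < 1. *)
have onem_ge : t <= 2 * (1 - expR (- t)).
  have : expR t * expR (- t) = 1 by rewrite -expRD subrr expR0.
  have := expR_ge1Dx t; nra.
have : N%:R * (1 - expR (- t)) <= e / 4.
  by rewrite mulrC -ler_pdivlMr// (le_trans onem_le)// ltW.
nra.
Unshelve. all: by end_near. Qed.

(** Abel's limit theorem for nonnegative coefficients: the value lies between a fixed partial sum at
    e^-t, which is continuous in t, and the full sum at 1. *)
Lemma cvg_Liexp_zetaR k : Liexp k.+2 t @[t --> (0 : R)^'+] --> zetaR R k.+2.
Proof.
apply/cvgrPdist_le => /= e e0.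
have C := @is_cvg_series_mcoef_single R k.
have [N HN] : exists N, zetaR R k.+2 - series (mcoef R [:: k.+2]) N <= e / 2.
  have /cvgrPdist_le /(_ (e / 2)) := C.
  rewrite divr_gt0// => /(_ isT) [N _ HN]; exists N.
  exact: le_trans (ler_norm _) (HN N (leqnn _)).
have f01 := mcoef01 (@mcoef_single_le1 R k.+2).
have : pseries (mcoef R [:: k.+2]) (expR (- t)) N @[t --> (0 : R)^'+] -->
    series (mcoef R [:: k.+2]) N.
  rewrite /pseries /series /=.
  apply: cvg_sumr => n.
  rewrite -[X in _ --> X]mulr1; apply: cvgM; first exact: cvg_cst.
  have X := cvg_right0_of_derive (is_derive_expRN (0 : R)).
  by move: X; rewrite oppr0 expR0 => /(@cvg_exprn _ _ _ _ _ _ n); rewrite expr1n.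
move=> /cvgrPdist_le /(_ (e / 2)); rewrite divr_gt0// => /(_ isT) HP.
apply: filterS2 (nbhs_right_gt (0 : R)) HP => t t0 HP.
have x0 : 0 <= expR (- t) by exact: expR_ge0.
have x1 : expR (- t) < 1 by rewrite expR_lt1 oppr_lt0.
have Plo := pseries_le_limn N f01 x0 x1.
have Phi : Liexp k.+2 t <= zetaR R k.+2.
  apply: ler_lim => //; first by apply: is_cvg_pseries_bounded => //; rewrite ger0_norm.
  apply: nearW => M; apply: ler_sum => n _.
  by rewrite -[leRHS]mulr1 ler_wpM2l ?mcoef_ge0// exprn_ile1// ltW.
rewrite ger0_norm ?subr_ge0//.
rewrite -/(polylog _ _) -/(Liexp _ _) in Plo.
have := le_trans (ler_norm _) HP; lra.
Qed.

Lemma cvg_dpow0 n : dpow n.+2 t @[t --> (0 : R)^'+] --> (0 : R).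
Proof.
have := cvg_right0_of_derive (is_derive_dpow n.+1 (0 : R)).
by rewrite dpowSS mul0r.
Qed.

(** Only q = j survives, and there the index m + j + 1 is at least 2. Every other term carries a
    factor t, which beats even Li_1(e^-t). *)
Lemma cvg_tailsum j m : (0 < j)%N ->
  tailsum j m t @[t --> (0 : R)^'+] --> 'C(m + j, m)%:R * zetaR R (m + j).+1.
Proof.
move=> j0.
have -> : 'C(m + j, m)%:R * zetaR R (m + j).+1 = \sum_(q < j.+1)
    'C(m + q, m)%:R * (if q == ord_max then zetaR R (m + j).+1 else 0).
  rewrite big_ord_recr /= eqxx big1 ?add0r// => q _.
  case: eqP => [/(congr1 val)/= qj|]; last by rewrite mulr0.
  by have := ltn_ord q; rewrite qj ltnn.
apply: cvg_sumr => q; apply: cvgM; first exact: cvg_cst.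
case: eqP => [->|/eqP qj] /=.
  rewrite subnn -[X in _ --> X]mul1r; apply: cvgM.
    have -> : dpow 1 = cst (1 : R) by apply/funext => x; rewrite dpow1.
    exact: cvg_cst.
  by case: j j0 {q} => // j _; rewrite addnS; exact: cvg_Liexp_zetaR.
have qj' : (q < j)%N.
  by rewrite ltn_neqAle -ltnS ltn_ord andbT.
rewrite -(subnSK qj').
have -> : (fun t => dpow (j - q.+1).+2 t * Liexp (m + q).+1 t) =
  (fun t => (t ^+ (j - q.+1) / (j - q.+1).+1`!%:R) * (t * Liexp (m + q).+1 t)).
  by apply/funext => t; rewrite dpowSS; ring.
rewrite -[X in _ --> X](mulr0 (0 ^+ (j - q.+1) / (j - q.+1).+1`!%:R)).
apply: cvgM; last exact: cvg_Liexp_mul.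
apply: cvgM; last exact: cvg_cst.
by apply: cvg_exprn; apply/cvg_at_right_filter; exact: cvg_id.
Qed.

(** Only i = m has no positive power of t. Its limit is cancelled by that of the tail sum, which
    enters the formula with the sign (-1)^(m+1). *)
Lemma cvg_zetasum j m :
  zetasum j m t @[t --> (0 : R)^'+] -->
    (-1) ^+ m * 'C(m + j, m)%:R * zetaR R (m + j).+1.
Proof.
have -> : (-1) ^+ m * 'C(m + j, m)%:R * zetaR R (m + j).+1 = \sum_(i < m.+1)
    ((-1) ^+ i * 'C(i + j, i)%:R * zetaR R (i + j + 1)) *
      (if i == ord_max then 1 else 0).
  rewrite big_ord_recr /= eqxx big1 ?add0r ?mulr1 ?addn1// => q _.
  case: eqP => [/(congr1 val)/= qj|]; last by rewrite mulr0.
  by have := ltn_ord q; rewrite qj ltnn.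
apply: cvg_sumr => q; apply: cvgM; first exact: cvg_cst.
case: eqP => [->|/eqP qj] /=.
  rewrite subnn; have -> : dpow 1 = cst (1 : R) by apply/funext => x; rewrite dpow1.
  exact: cvg_cst.
have qj' : (q < m)%N by rewrite ltn_neqAle -ltnS ltn_ord andbT.
by rewrite -(subnSK qj'); exact: cvg_dpow0.
Qed.

Lemma cvg_polylog_onem k ks : (forall n, mcoef R (k :: ks) n <= 1) ->
  polylog (k :: ks) (1 - expR (- t)) @[t --> (0 : R)^'+] --> (0 : R).
Proof.
move=> H.
have D := @is_derive1_comp _ _ (fun t => 1 - expR (- t)) _ _ _
  (is_derive_pseries (mcoef01 H) (onem_expRN_lt1 (lexx 0))) (is_derive_onem_expRN 0).
have := cvg_right0_of_derive D.
by rewrite /= oppr0 expR0 subrr pseries_at0 mcoef0.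
Qed.

Lemma polylog_ones j t : 0 < t ->
  polylog (nseq j 1%N) (1 - expR (- t)) = dpow j.+1 t.
Proof.
elim: j t => [|j IH] t t0; first by rewrite polylog_nil dpow1.
have H i n : mcoef R (nseq i 1%N) n <= 1.
  by apply: mcoef_path_le1; apply/allP => x /nseqP[->].
apply/eqP; rewrite -subr_eq0; apply/eqP.
apply: (@eq0_derive0_right R (fun t =>
  polylog (nseq j.+1 1%N) (1 - expR (- t)) - dpow j.+2 t) t _ _ t0).
  move=> u u0; rewrite -(subrr (dpow j.+1 u)) -{1}IH//; apply: is_deriveB.
  - exact: (is_derive_polylog1_onem (H j) (ltW u0)).
  - exact: is_derive_dpow.
rewrite -[X in _ --> X](subrr 0); apply: cvgB; last exact: cvg_dpow0.
exact: (cvg_polylog_onem (H j.+1)).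
Qed.

Lemma polylog_formula j m t : (0 < j)%N -> 0 < t ->
  polylog (nseq m 1%N ++ 2%N :: nseq j.-1 1%N) (1 - expR (- t)) =
  zetasum j m t + (-1) ^+ m.+1 * tailsum j m t.
Proof.
move=> j0.
have H i n : mcoef R (nseq i 1%N ++ 2%N :: nseq j.-1 1%N) n <= 1.
  apply: mcoef_path_le1; rewrite all_cat /=.
  by apply/andP; split; apply/allP => x /nseqP[->].
have H0 i n : mcoef R (nseq i 1%N) n <= 1.
  by apply: mcoef_path_le1; apply/allP => x /nseqP[->].
elim: m t => [|m IH] t t0; apply/eqP; rewrite -subr_eq0; apply/eqP.
- apply: (@eq0_derive0_right R (fun t =>
    polylog (2%N :: nseq j.-1 1%N) (1 - expR (- t)) -
      (zetasum j 0 t + (-1) ^+ 1 * tailsum j 0 t)) t _ _ t0).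
    move=> u u0; apply: is_derive_eq.
      apply: is_deriveB; first exact: (is_derive_polylog2_onem (H0 j.-1) u0).
      apply: is_deriveD; first exact: is_derive_zetasum0.
      by apply: is_deriveZ; exact: is_derive_tailsum0.
    (* Removing one unit from the 2 leaves exactly [j] ones, hence t^j / j!, and Li_0(e^-t) is the
       remaining factor 1 / (e^t - 1). *)
    rewrite -[1%N :: _]/(nseq j.-1.+1 1%N) prednK// polylog_ones//.
    rewrite /Liexp polylog_single0// /GRing.scale /=; ring.
  rewrite -[X in _ --> X](subrr 0); apply: cvgB.
    exact: (cvg_polylog_onem (H 0%N)).
  rewrite [X in _ --> X](_ : 0 = (-1) ^+ 0 * 'C(0 + j, 0)%:R * zetaR R (0 + j).+1 +
    (-1) ^+ 1 * ('C(0 + j, 0)%:R * zetaR R (0 + j).+1)); last by ring.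
  apply: cvgD; first exact: cvg_zetasum.
  by apply: cvgM; [exact: cvg_cst|exact: cvg_tailsum].
- apply: (@eq0_derive0_right R (fun t =>
    polylog (1%N :: nseq m 1%N ++ 2%N :: nseq j.-1 1%N) (1 - expR (- t)) -
      (zetasum j m.+1 t + (-1) ^+ m.+2 * tailsum j m.+1 t)) t _ _ t0).
    move=> u u0; apply: is_derive_eq.
      apply: is_deriveB.
        exact: (is_derive_polylog1_onem (H m) (ltW u0)).
      apply: is_deriveD; first exact: is_derive_zetasumS.
      by apply: is_deriveZ; exact: is_derive_tailsumS.
    rewrite IH// /GRing.scale /= (exprS _ m.+1); ring.
  rewrite -[X in _ --> X](subrr 0); apply: cvgB.
    exact: (cvg_polylog_onem (H m.+1)).
  rewrite [X in _ --> X](_ : 0 = (-1) ^+ m.+1 * 'C(m.+1 + j, m.+1)%:R * zetaR R (m.+1 + j).+1 +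
    (-1) ^+ m.+2 * ('C(m.+1 + j, m.+1)%:R * zetaR R (m.+1 + j).+1)); last first.
    by rewrite (exprS _ m.+1); ring.
  apply: cvgD; first exact: cvg_zetasum.
  by apply: cvgM; [exact: cvg_cst|exact: cvg_tailsum].
Qed.

End right_limits_at_0.

(** * Integrals over the positive half-line *)

Section real_integrals.
Variable R : realType.
Local Notation mu := (@lebesgue_measure R).
Local Notation D := (`]0%R, +oo[%classic : set (measurableTypeR R)).

Lemma measurable_Rpos : measurable D. Proof. exact: measurable_itv. Qed.

Definition posint (f : R -> R) := mu.-integrable D (EFin \o f).

Lemma posint_eq (f g : R -> R) : (forall t, 0 < t -> f t = g t) ->
  posint f -> posint g.
Proof.
move=> fg; apply: eq_integrable; first exact: measurable_Rpos.
by move=> t; rewrite inE/= in_itv/= andbT => t0; rewrite fg.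
Qed.

Lemma posint_measurable (f : R -> R) : posint f -> measurable_fun D f.
Proof. by move=> /integrableP[/measurable_EFinP]. Qed.

Lemma posint_le (f g : R -> R) : measurable_fun D f ->
  (forall t, 0 < t -> `|f t| <= g t) -> posint g -> posint f.
Proof.
move=> mf fg; apply: le_integrable; first exact: measurable_Rpos.
  exact/measurable_EFinP.
move=> t; rewrite /= in_itv/= andbT => t0; rewrite lee_fin.
by rewrite (le_trans (fg _ t0))// ler_norm.
Qed.

Lemma posintZ (k : R) (f : R -> R) : posint f -> posint (fun t => k * f t).
Proof. by move=> H; exact: (integrableZl measurable_Rpos k H). Qed.

Lemma posintD (f g : R -> R) : posint f -> posint g -> posint (fun t => f t + g t).
Proof. by move=> H1 H2; exact: (integrableD measurable_Rpos H1 H2). Qed.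

Lemma posintB (f g : R -> R) : posint f -> posint g -> posint (fun t => f t - g t).
Proof. by move=> H1 H2; exact: (integrableB measurable_Rpos H1 H2). Qed.

Lemma eq_posRint (f g : R -> R) : (forall t, 0 < t -> f t = g t) ->
  Rintegral mu D f = Rintegral mu D g.
Proof.
by move=> fg; apply: eq_Rintegral => t; rewrite inE/= in_itv/= andbT => /fg.
Qed.

Lemma posint_dominated (f_ : nat -> R -> R) (f g : R -> R) :
  (forall n, measurable_fun D (f_ n)) ->
  (forall t, 0 < t -> f_ n t @[n --> \oo] --> f t) ->
  posint g -> (forall n t, 0 < t -> `|f_ n t| <= g t) ->
  posint f /\ Rintegral mu D (f_ n) @[n --> \oo] --> Rintegral mu D f.
Proof.
move=> mf_ ff ig fg.
have Dp t : D t -> 0 < t by rewrite /= in_itv/= andbT.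
have mf : measurable_fun D f.
  by apply: (@measurable_fun_cvg _ _ _ _ f_) => // t /Dp; exact: ff.
have [] := @dominated_convergence _ _ R mu D measurable_Rpos
  (fun n => EFin \o f_ n) (EFin \o f) (EFin \o g).
- by move=> n; exact/measurable_EFinP.
- exact/measurable_EFinP.
- by apply: aeW => t /Dp t0; apply/cvg_EFin; [exact: nearW|exact: ff].
- exact: ig.
- by apply: aeW => t n /Dp t0; rewrite /= lee_fin; exact: fg.
move=> pf _ C; split => //.
apply: fine_cvg; rewrite fineK; first exact: C.
by apply: integrable_fin_num => //; exact: measurable_Rpos.
Qed.

(** Supplies the dominating function of [mellin], which is known only as an increasing limit of
    functions with bounded integrals. *)
Lemma posint_monotone (f_ : nat -> R -> R) (f : R -> R) (M : R) :
  (forall n, posint (f_ n)) ->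
  (forall n t, 0 < t -> 0 <= f_ n t) ->
  (forall t, 0 < t -> nondecreasing_seq (f_ ^~ t)) ->
  (forall t, 0 < t -> f_ n t @[n --> \oo] --> f t) ->
  (forall n, Rintegral mu D (f_ n) <= M) ->
  posint f.
Proof.
move=> if_ f0 fnd ff fM.
have Dp t : D t -> 0 < t by rewrite /= in_itv/= andbT.
have mf_ n : measurable_fun D (f_ n) by exact: posint_measurable.
have mf : measurable_fun D f.
  by apply: (@measurable_fun_cvg _ _ _ _ f_) => // t /Dp; exact: ff.
have fpos t : 0 < t -> 0 <= f t.
  move=> t0; rewrite -(cvg_lim (@Rhausdorff R) (ff t t0)).
  apply: limr_ge; first by apply/cvg_ex; exists (f t); exact: ff.
  by apply: nearW => n; exact: f0.
apply/integrableP; split; first exact/measurable_EFinP.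
rewrite (_ : (\int[mu]_(x in D) `|(EFin \o f) x| =
  \int[mu]_(x in D) limn (fun n => (f_ n x)%:E))%E); last first.
  apply: eq_integral => t; rewrite inE => /Dp t0.
  rewrite /= ger0_norm ?fpos//; apply/esym/cvg_lim => //.
  by apply/cvg_EFin; [exact: nearW|exact: ff].
rewrite monotone_convergence.
- apply: (@le_lt_trans _ _ M%:E); last exact: ltry.
  apply: lime_le.
    apply: ereal_nondecreasing_is_cvgn => n m nm; apply: ge0_le_integral.
    + exact: measurable_Rpos.
    + by move=> t /Dp t0; rewrite lee_fin f0.
    + exact/measurable_EFinP.
    + exact/measurable_EFinP.
    + by move=> t /Dp t0; rewrite lee_fin fnd.
  apply: nearW => n; rewrite -(@fineK _ (\int[mu]_(x in D) (f_ n x)%:E)%E).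
    by rewrite lee_fin; exact: fM.
  by apply: integrable_fin_num; [exact: measurable_Rpos|exact: if_].
- exact: measurable_Rpos.
- by move=> n; exact/measurable_EFinP.
- by move=> n t /Dp t0; rewrite lee_fin f0.
- by move=> t /Dp t0 n m nm; rewrite lee_fin fnd.
Qed.

Lemma preimage_mul_pos (k : R) : 0 < k -> ( *%R k) @^-1` D = D.
Proof.
move=> k0; apply/seteqP; split => t /=; rewrite !in_itv/= !andbT.
  by rewrite pmulr_rgt0.
by move=> t0; rewrite mulr_gt0.
Qed.

(** The pushforward of Lebesgue measure under multiplication by [k], scaled by [k], has the right
    value on half-open intervals, hence is Lebesgue measure by uniqueness. *)
Lemma ge0_integral_scale (f : R -> \bar R) (k : R) : 0 < k ->
  measurable_fun D f -> (forall t, 0 < t -> (0 <= f t)%E) ->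
  (\int[mu]_(t in D) f t = k%:E * \int[mu]_(t in D) f (k * t)%R)%E.
Proof.
move=> k0 mf f0.
pose kn := NngNum (ltW k0).
pose h : measurableTypeR R -> measurableTypeR R := *%R k.
have mh : measurable_fun setT h by exact: mulrl_measurable.
have -> : (\int[mu]_(t in D) f (k * t)%R =
    \int[pushforward mu h]_(t in D) f t)%E.
  rewrite ge0_integral_pushforward ?preimage_mul_pos//.
  by move=> t; rewrite inE/= in_itv/= andbT => /f0.
rewrite -[k]/(kn%:num) -ge0_integral_mscale //; last first.
  by move=> t; rewrite /= in_itv/= andbT => /f0.
apply: eq_measure_integral => A mA _.
apply: lebesgue_measure_unique => // _ [[a b]] _ <-.
change (mu `]a, b] = (k%:E * mu (h @^-1` `]a, b]%classic))%E).
have -> : h @^-1` `]a, b] = `]k^-1 * a, k^-1 * b]%classic.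
  apply/seteqP; split => t /=; rewrite !in_itv/= /h;
  by rewrite -[k^-1 * a < t](ltr_pM2l k0) -[t <= k^-1 * b](ler_pM2l k0) !mulVKf ?gt_eqF.
rewrite !lebesgue_measure_itv/= !lte_fin ltr_pM2l ?invr_gt0//.
case: ifPn => _; last by rewrite mule0.
by rewrite -EFinM -mulrBr mulVKf ?gt_eqF.
Qed.

Lemma posint_scale (f : R -> R) (k : R) : 0 < k -> posint f ->
  posint (fun t => f (k * t)) /\
  Rintegral mu D (fun t => f (k * t)) = k^-1 * Rintegral mu D f.
Proof.
move=> k0 pf.
pose h : measurableTypeR R -> measurableTypeR R := *%R k.
have mh : measurable_fun D h by exact: mulrl_measurable.
have mfh : measurable_fun D (f \o h).
  apply: (@measurable_comp _ _ _ _ _ _ D) => //; last exact: posint_measurable.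
  move=> _ [t + <-]; rewrite /= !in_itv/= !andbT => t0; exact: mulr_gt0.
have I (g : R -> \bar R) : measurable_fun D g -> (forall t, 0 < t -> (0 <= g t)%E) ->
    (\int[mu]_(t in D) g (k * t)%R = k^-1%:E * \int[mu]_(t in D) g t)%E.
  move=> mg g0; rewrite (ge0_integral_scale k0 mg g0) muleA -EFinM.
  by rewrite mulVf ?gt_eqF// mul1e.
have pfh : posint (fun t => f (k * t)).
  apply/integrableP; split; first exact/measurable_EFinP.
  have := I (fun t => `|(f t)%:E|%E) => /= ->.
  - have /integrableP[_ H] := pf.
    rewrite lte_mul_pinfty// ?lee_fin ?invr_ge0 ?ltW//.
  - by apply/measurable_EFinP; apply: measurableT_comp => //; exact: posint_measurable.
  - by move=> t _.
split=> //.
have Dpm : measurable D by exact: measurable_Rpos.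
apply: EFin_inj; rewrite EFinM /Rintegral !fineK; first last.
- exact: integrable_fin_num.
- exact: integrable_fin_num.
rewrite integralE [in RHS]integralE.
have mf : measurable_fun D (EFin \o f) by have /integrableP[] := pf.
transitivity (k^-1%:E * \int[mu]_(t in D) (EFin \o f)^\+ t -
    k^-1%:E * \int[mu]_(t in D) (EFin \o f)^\- t)%E; last first.
  by rewrite -muleBr//; exact: integrable_add_def.
rewrite -!I//; [|exact: measurable_funeneg|exact: measurable_funepos].
by congr (_ - _)%E; apply: eq_integral => x _; rewrite !(funeposE, funenegE).
Qed.

End real_integrals.

(** * Complex powers and complex integrals *)

Section complex_powers.
Variable R : realType.
Implicit Types (z w : R[i]) (x y t : R).
Local Notation Re := (@complex.Re R).
Local Notation Im := (@complex.Im R).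

Lemma complexReD z w : Re (z + w) = Re z + Re w. Proof. by case: z w => ? ? []. Qed.
Lemma complexImD z w : Im (z + w) = Im z + Im w. Proof. by case: z w => ? ? []. Qed.
Lemma complexReM z w : Re (z * w) = Re z * Re w - Im z * Im w.
Proof. by case: z w => ? ? []. Qed.
Lemma complexImM z w : Im (z * w) = Re z * Im w + Im z * Re w.
Proof. by case: z w => ? ? []. Qed.

Lemma complexReN z : Re (- z) = - Re z. Proof. by case: z. Qed.
Lemma complexImN z : Im (- z) = - Im z. Proof. by case: z. Qed.

Lemma complexReMr z x : Re (z * x%:C) = Re z * x.
Proof. by rewrite complexReM /= mulr0 subr0. Qed.
Lemma complexImMr z x : Im (z * x%:C) = Im z * x.
Proof. by rewrite complexImM /= mulr0 add0r. Qed.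

Lemma complex_ext z w : Re z = Re w -> Im z = Im w -> z = w.
Proof. by case: z w => ? ? [? ?] /= -> ->. Qed.

Lemma complexReDn z n : Re (z + n%:R) = Re z + n%:R.
Proof. by elim: n => [|n IH]; rewrite ?addr0// -!natr1 !addrA complexReD IH. Qed.

Lemma complexImDn z n : Im (z + n%:R) = Im z.
Proof. by elim: n => [|n IH]; rewrite ?addr0// -!natr1 !addrA complexImD IH /= addr0. Qed.

Lemma cexpD z w : cexp (z + w) = cexp z * cexp w.
Proof.
apply: complex_ext; rewrite /cexp !(complexReM, complexImM) complexReD complexImD /=
  expRD cosD sinD; ring.
Qed.

Lemma cexp0 : cexp (0 : R[i]) = 1.
Proof.
by apply: complex_ext; rewrite /cexp !(complexReM, complexImM) /= expR0 cos0 sin0; ring.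
Qed.

Lemma cexp_neq0 z : cexp z != 0.
Proof.
apply/eqP => z0; have := cexp0; rewrite -(subrr z) cexpD z0 mul0r => /eqP.
by rewrite eq_sym oner_eq0.
Qed.

Lemma cpow_neq0 x z : cpow x z != 0. Proof. exact: cexp_neq0. Qed.

Lemma cpowD x z w : cpow x (z + w) = cpow x z * cpow x w.
Proof. by rewrite /cpow mulrDl cexpD. Qed.

Lemma cpow0 x : cpow x (0 : R[i]) = 1.
Proof. by rewrite /cpow mul0r cexp0. Qed.

Lemma cpowM x y z : 0 < x -> 0 < y -> cpow (x * y) z = cpow x z * cpow y z.
Proof.
move=> x0 y0; rewrite /cpow -cexpD -mulrDr lnM ?posrE//; congr (cexp (_ * _)).
by apply: complex_ext; rewrite ?complexReD ?complexImD /= ?addr0.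
Qed.

Lemma cpow_1 x : 0 < x -> cpow x 1 = x%:C.
Proof.
move=> x0; rewrite /cpow mul1r; apply: complex_ext;
  by rewrite /cexp !(complexReM, complexImM) /= cos0 sin0 lnK ?posrE//; ring.
Qed.

Lemma cpow_nat x n : 0 < x -> cpow x n%:R = (x ^+ n)%:C.
Proof.
move=> x0; elim: n => [|n IH]; first by rewrite cpow0 expr0.
by rewrite mulrSr cpowD IH cpow_1// exprSr; apply: complex_ext;
  rewrite !(complexReM, complexImM) /=; ring.
Qed.

Lemma Re_cpow x z : Re (cpow x z) = expR (Re z * ln x) * cos (Im z * ln x).
Proof.
rewrite /cpow /cexp complexReM complexReM complexImM /= !mulr0 mul0r subr0 add0r.
by rewrite subr0.
Qed.

Lemma Im_cpow x z : Im (cpow x z) = expR (Re z * ln x) * sin (Im z * ln x).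
Proof.
rewrite /cpow /cexp complexImM complexReM complexImM /= !mulr0 mul0r addr0 subr0.
by rewrite add0r.
Qed.

Lemma normRe_cpow x z : `|Re (cpow x z)| <= expR (Re z * ln x).
Proof.
by rewrite Re_cpow normrM ger0_norm ?expR_ge0// -[leRHS]mulr1
  ler_wpM2l ?expR_ge0// ler_norml cos_geN1 cos_le1.
Qed.

Lemma normIm_cpow x z : `|Im (cpow x z)| <= expR (Re z * ln x).
Proof.
by rewrite Im_cpow normrM ger0_norm ?expR_ge0// -[leRHS]mulr1
  ler_wpM2l ?expR_ge0// ler_norml sin_geN1 sin_le1.
Qed.

Lemma cvg_complex (u : nat -> R[i]) (l : R[i]) :
  Re (u n) @[n --> \oo] --> Re l -> Im (u n) @[n --> \oo] --> Im l ->
  (u : nat -> R[i]^o) @ \oo --> (l : R[i]^o).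
Proof.
move=> /cvgrPdist_lt ur /cvgrPdist_lt ui.
apply/cvgrPdist_lt => e e0.
(* The tolerance is itself an element of [R[i]]; being positive it is real, and half of its real
   part serves for each component. *)
have eI : Im e = 0 by apply: ger0_Im; exact: ltW.
have eR : 0 < Re e / 2 by move: e0; rewrite ltcE /= => /andP[_ ?]; rewrite divr_gt0.
near=> n.
have h1 : `|Re l - Re (u n)| < Re e / 2 by near: n; exact: ur.
have h2 : `|Im l - Im (u n)| < Re e / 2 by near: n; exact: ui.
have -> : l - u n = (Re l - Re (u n))%:C + 'i%C * (Im l - Im (u n))%:C.
  by apply: complex_ext; rewrite !(complexReD, complexImD, complexReM, complexImM) /=;
    case: (u n) => ? ? /=; ring.
apply: le_lt_trans (ler_normD _ _) _; rewrite normrM !normc_def /=.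
rewrite expr0n /= addr0 expr1n add0r addr0 sqrtr1 mul1r !sqrtr_sqr.
rewrite ltcE /= addr0 eI eqxx /=; lra.
Unshelve. all: by end_near. Qed.

End complex_powers.

(** * Componentwise integration of complex-valued functions *)

Section complex_integrals.
Variable R : realType.
Local Notation mu := (@lebesgue_measure R).
Local Notation D := (`]0%R, +oo[%classic : set (measurableTypeR R)).
Local Notation Re := (@complex.Re R).
Local Notation Im := (@complex.Im R).
Implicit Types f g : R -> R[i].

(** [Rintegral] assigns a value to every function, but its linearity lemmas require integrability,
    so the latter accompanies each computed value below. *)
Definition Cposint f := posint (Re \o f) /\ posint (Im \o f).
Definition Cint f : R[i] := Cintegral `]0, +oo[ f.

Lemma Re_Cint f : Re (Cint f) = Rintegral mu D (fun t => Re (f t)). Proof. by []. Qed.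
Lemma Im_Cint f : Im (Cint f) = Rintegral mu D (fun t => Im (f t)). Proof. by []. Qed.

Lemma Cposint_eq f g : (forall t, 0 < t -> f t = g t) -> Cposint f -> Cposint g.
Proof.
by move=> fg [H1 H2]; split; [apply: posint_eq H1|apply: posint_eq H2] => t t0 /=; rewrite fg.
Qed.

Lemma eq_Cint f g : (forall t, 0 < t -> f t = g t) -> Cint f = Cint g.
Proof.
by move=> fg; congr (_ +i* _); apply: eq_posRint => t t0; rewrite fg.
Qed.

Lemma CposintD f g : Cposint f -> Cposint g ->
  Cposint (fun t => f t + g t) /\ Cint (fun t => f t + g t) = Cint f + Cint g.
Proof.
move=> [f1 f2] [g1 g2]; split.
  split.
    by apply: posint_eq (posintD f1 g1) => t _ /=; rewrite complexReD.
  by apply: posint_eq (posintD f2 g2) => t _ /=; rewrite complexImD.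
have mD := @measurable_Rpos R.
apply: complex_ext; rewrite ?complexReD ?complexImD /=.
  by under eq_posRint do rewrite complexReD; rewrite (RintegralD mD f1 g1).
by under eq_posRint do rewrite complexImD; rewrite (RintegralD mD f2 g2).
Qed.

Lemma CposintZ (c : R[i]) f : Cposint f ->
  Cposint (fun t => c * f t) /\ Cint (fun t => c * f t) = c * Cint f.
Proof.
move=> [f1 f2]; have mD := @measurable_Rpos R.
split.
  split.
    by apply: posint_eq (posintB (posintZ (Re c) f1) (posintZ (Im c) f2)) => t _ /=;
      rewrite complexReM.
  by apply: posint_eq (posintD (posintZ (Re c) f2) (posintZ (Im c) f1)) => t _ /=;
      rewrite complexImM.
apply: complex_ext; rewrite ?complexReM ?complexImM /=.
  under eq_posRint do rewrite complexReM.
  by rewrite (RintegralB mD (posintZ (Re c) f1) (posintZ (Im c) f2))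
    (RintegralZl _ mD f1) (RintegralZl _ mD f2).
under eq_posRint do rewrite complexImM.
by rewrite (RintegralD mD (posintZ (Re c) f2) (posintZ (Im c) f1))
    (RintegralZl _ mD f1) (RintegralZl _ mD f2).
Qed.

Lemma Cposint0 : Cposint (fun=> 0) /\ Cint (fun=> 0) = 0.
Proof.
split; first by split; exact: integrable0.
by apply: complex_ext => /=; rewrite Rintegral_cst ?mul0r//; exact: measurable_Rpos.
Qed.

Lemma Cposint_sum (I : Type) (s : seq I) (f : I -> R -> R[i]) :
  (forall i, Cposint (f i)) ->
  Cposint (fun t => \sum_(i <- s) f i t) /\
  Cint (fun t => \sum_(i <- s) f i t) = \sum_(i <- s) Cint (f i).
Proof.
move=> H; elim: s => [|i s [IH1 IH2]].
  by rewrite big_nil; under eq_fun do rewrite big_nil; exact: Cposint0.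
rewrite big_cons; under eq_fun do rewrite big_cons.
by rewrite -IH2; apply: CposintD.
Qed.

Lemma Cposint_scale (k : R) f : 0 < k -> Cposint f ->
  Cposint (fun t => f (k * t)) /\ Cint (fun t => f (k * t)) = (k^-1)%:C * Cint f.
Proof.
move=> k0 [/(posint_scale k0)[f1 f1'] /(posint_scale k0)[f2 f2']]; split; first by split.
apply: complex_ext; rewrite ?complexReM ?complexImM /= ?mul0r ?subr0 ?addr0.
  exact: f1'.
exact: f2'.
Qed.

Lemma Cposint_dominated (f_ : nat -> R -> R[i]) f (g : R -> R) :
  (forall n, measurable_fun D (Re \o f_ n)) ->
  (forall n, measurable_fun D (Im \o f_ n)) ->
  (forall t, 0 < t -> Re (f_ n t) @[n --> \oo] --> Re (f t)) ->
  (forall t, 0 < t -> Im (f_ n t) @[n --> \oo] --> Im (f t)) ->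
  posint g -> (forall n t, 0 < t -> `|Re (f_ n t)| <= g t) ->
  (forall n t, 0 < t -> `|Im (f_ n t)| <= g t) ->
  [/\ Cposint f, Re (Cint (f_ n)) @[n --> \oo] --> Re (Cint f) &
      Im (Cint (f_ n)) @[n --> \oo] --> Im (Cint f)].
Proof.
move=> m1 m2 l1 l2 ig b1 b2.
have [i1 c1] := posint_dominated m1 l1 ig b1.
have [i2 c2] := posint_dominated m2 l2 ig b2.
by split.
Qed.

Lemma measurable_Re_cpow (z : R[i]) : measurable_fun D (fun t => Re (cpow t z)).
Proof.
apply: (eq_measurable_fun
  (fun t => expR (Re z * ln t) * cos (Im z * ln t))).
  by move=> t _; rewrite Re_cpow.
apply: measurable_funM; apply: measurable_funTS.
  apply: measurableT_comp => //; apply: measurable_funM => //; exact: measurable_ln.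
apply: measurableT_comp; first by apply: continuous_measurable_fun; exact: continuous_cos.
by apply: measurable_funM => //; exact: measurable_ln.
Qed.

Lemma measurable_Im_cpow (z : R[i]) : measurable_fun D (fun t => Im (cpow t z)).
Proof.
apply: (eq_measurable_fun
  (fun t => expR (Re z * ln t) * sin (Im z * ln t))).
  by move=> t _; rewrite Im_cpow.
apply: measurable_funM; apply: measurable_funTS.
  apply: measurableT_comp => //; apply: measurable_funM => //; exact: measurable_ln.
apply: measurableT_comp; first by apply: continuous_measurable_fun; exact: continuous_sin.
by apply: measurable_funM => //; exact: measurable_ln.
Qed.

Lemma measurable_expRN : measurable_fun D (fun t : R => expR (- t)).
Proof. by apply: measurable_funTS; apply: measurableT_comp. Qed.

Lemma measurable_expR_ln (a : R) : measurable_fun D (fun t : R => expR (a * ln t)).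
Proof.
apply: measurable_funTS; apply: measurableT_comp => //.
by apply: measurable_funM => //; exact: measurable_ln.
Qed.

Lemma posint_expRN_half : posint (fun t : R => expR (- t / 2)).
Proof.
have h : 0 < (2^-1 : R) by rewrite invr_gt0.
have H : posint (exponential_pdf (2^-1 : R)).
  by apply: integrableS (integrable_exponential_pdf h) => //; exact: measurable_Rpos.
apply: posint_eq (posintZ 2 H) => t t0.
by rewrite exponential_pdfE ?ltW// mulrA divff// mul1r mulNr mulrC mulNr.
Qed.

(** This is ln x <= x - 1 at x = t / (2b). The scale 2b makes the linear term t/2, so that t^b costs
    only half of the decay of e^-t. *)
Lemma mulr_ln_le (b t : R) : 0 < b -> 0 < t ->
  b * ln t <= t / 2 + b * (ln (2 * b) - 1).
Proof.
move=> b0 t0; have b20 : 0 < 2 * b by rewrite mulr_gt0.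
have : ln (t / (2 * b)) <= t / (2 * b) - 1.
  have -> : t / (2 * b) = 1 + (t / (2 * b) - 1) by rewrite addrC subrK.
  rewrite [leRHS]addrAC subrr add0r.
  by apply: le_ln1Dx; rewrite ltrBrDl subrr divr_gt0.
rewrite ln_div ?posrE// lerBlDr -(ler_pM2l b0).
have -> // : b * (t / (2 * b) - 1 + ln (2 * b)) = t / 2 + b * (ln (2 * b) - 1).
by field; rewrite gt_eqF.
Qed.

(** For a > 1 the integrand stays bounded near 0, so a multiple of e^(-t/2) dominates it on the
    whole half-line. *)
Lemma posint_gamma (a : R) : 1 < a ->
  posint (fun t => expR ((a - 1) * ln t) * expR (- t)).
Proof.
move=> a1; set b := a - 1; have b0 : 0 < b by rewrite subr_gt0.
apply: posint_le (posintZ (expR (b * (ln (2 * b) - 1))) posint_expRN_half).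
  by apply: measurable_funM; [exact: measurable_expR_ln|exact: measurable_expRN].
move=> t t0; rewrite ger0_norm ?mulr_ge0 ?expR_ge0// -!expRD ler_expR.
have := mulr_ln_le b0 t0; lra.
Qed.

Lemma Cposint_gamma (w : R[i]) : 1 < Re w ->
  Cposint (fun t => cpow t (w - 1) * (expR (- t))%:C).
Proof.
move=> w1; have E : Re (w - 1) = Re w - 1 by rewrite complexReD.
split; apply: posint_le (posint_gamma w1).
- apply: (eq_measurable_fun (fun t => Re (cpow t (w - 1)) * expR (- t))).
    by move=> t _; rewrite -complexReMr.
  by apply: measurable_funM; [exact: measurable_Re_cpow|exact: measurable_expRN].
- move=> t t0; rewrite [(_ \o _) t]complexReMr normrM (ger0_norm (expR_ge0 _)).
  by rewrite ler_wpM2r ?expR_ge0// -E normRe_cpow.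
- apply: (eq_measurable_fun (fun t => Im (cpow t (w - 1)) * expR (- t))).
    by move=> t _; rewrite -complexImMr.
  by apply: measurable_funM; [exact: measurable_Im_cpow|exact: measurable_expRN].
- move=> t t0; rewrite [(_ \o _) t]complexImMr normrM (ger0_norm (expR_ge0 _)).
  by rewrite ler_wpM2r ?expR_ge0// -E normIm_cpow.
Qed.

End complex_integrals.

(** * The Gamma function *)

Section gamma.
Variable R : realType.
Local Notation mu := (@lebesgue_measure R).
Local Notation D := (`]0%R, +oo[%classic : set (measurableTypeR R)).
Local Notation Re := (@complex.Re R).
Local Notation Im := (@complex.Im R).

(** The fundamental theorem on the growing intervals [1/(n+1), n+2], followed by dominated
    convergence with |f|. The right end n + 2 keeps the interval nondegenerate at n = 0. *)
Lemma Rintegral_derive0 (F f : R -> R) :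
  (forall t : R, 0 < t -> is_derive t (1 : R) F (f t)) ->
  (forall t : R, 0 < t -> {for t, continuous f}) ->
  posint f ->
  F (n.+1%:R^-1) @[n --> \oo] --> (0 : R) -> F n.+2%:R @[n --> \oo] --> (0 : R) ->
  Rintegral mu D f = 0.
Proof.
move=> dF cf pf F0 Foo.
pose A n : set (measurableTypeR R) := `[(n.+1%:R^-1 : R), n.+2%:R]%classic.
have mA n : measurable (A n) by exact: measurable_itv.
have AD n : A n `<=` D.
  move=> t; rewrite /A /= !in_itv/= andbT => /andP[+ _].
  by apply: lt_le_trans; rewrite invr_gt0.
have n12 n : n.+1%:R^-1 < n.+2%:R :> R.
  apply: (@le_lt_trans _ _ 1); last by rewrite ltr1n.
  by rewrite invf_le1// ler1n.
have I n : Rintegral mu D (f \_ (A n)) = F n.+2%:R - F n.+1%:R^-1.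
  rewrite -Rintegral_mkcondr setIidr// /Rintegral.
  rewrite (@continuous_FTC2 _ f F)//.
  - apply: continuous_in_subspaceT => t; rewrite inE/= in_itv/= => /andP[t0 _].
    by apply: cf; apply: lt_le_trans t0; rewrite invr_gt0.
  - have c t : 0 < t -> {for t, continuous F}.
      by move=> /dF[/derivable1_diffP/differentiable_continuous].
    split.
    + move=> t; rewrite in_itv/= => /andP[t0 _].
      have t0' : 0 < t by apply: lt_trans t0; rewrite invr_gt0.
      by have [] := dF t t0'.
    + by apply/cvg_at_right_filter; apply: c; rewrite invr_gt0.
    + by apply/cvg_at_left_filter; apply: c.
  - move=> t; rewrite in_itv/= => /andP[t0 _].
    have t0' : 0 < t by apply: lt_trans t0; rewrite invr_gt0.
    by rewrite derive1E; have [_ ->] := dF t t0'.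
have [||||_ C] := @posint_dominated R (fun n => f \_ (A n)) f (fun t => `|f t|).
- move=> n; apply/measurable_restrict => //.
  by apply: measurable_funS (posint_measurable pf) => //; exact: measurable_Rpos.
- move=> t t0; apply: cvg_near_cst.
  have [N HN] : exists N, t^-1 <= N%:R.
    by exists (Num.trunc t^-1).+1; rewrite ltW// truncnS_gt.
  have [M HM] : exists M, t <= M%:R.
    by exists (Num.trunc t).+1; rewrite ltW// truncnS_gt.
  exists (maxn N M) => // n /= nm.
  rewrite patchE ifT// inE /A /= in_itv/=; apply/andP; split.
    rewrite invf_ple ?posrE// (le_trans HN)// ler_nat.
    by rewrite (leq_trans (leq_maxl N M))// (leq_trans nm).
  rewrite (le_trans HM)// ler_nat.
  by rewrite (leq_trans (leq_maxr N M))// (leq_trans nm)// leqW.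
- exact: integrable_norm.
- by move=> n t t0; rewrite patchE; case: ifP => //; rewrite normr0.
have C0 : (fun n => Rintegral mu D (f \_ (A n))) @ \oo --> (0 : R).
  by rewrite (funext I) -[X in _ --> X](subrr 0); exact: cvgB.
exact: (cvg_unique (@Rhausdorff R) C C0).
Qed.

Lemma cpowB1 (t : R) (w : R[i]) : 0 < t -> cpow t (w - 1) = cpow t w * (t^-1)%:C.
Proof.
move=> t0; rewrite -[in RHS](subrK 1 w) (cpowD _ (w - 1) 1) cpow_1// -mulrA.
by rewrite -[_%:C * _]rmorphM mulfV ?gt_eqF// mulr1.
Qed.

Lemma is_derive_mulln (a t : R) : 0 < t ->
  is_derive t (1 : R) (fun t => a * ln t) (a / t).
Proof. by move=> t0; apply: is_deriveZ; exact: is_derive1_ln. Qed.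

Lemma is_derive_Re_cpow (t : R) (w : R[i]) : 0 < t ->
  is_derive t (1 : R) (fun t => Re (cpow t w)) (Re (w * cpow t (w - 1))).
Proof.
move=> t0; have -> : (fun t => Re (cpow t w)) =
  (fun t => expR (Re w * ln t) * cos (Im w * ln t)) by apply/funext => x; rewrite Re_cpow.
have D1 := @is_derive1_comp _ _ (fun t => Re w * ln t) _ _ _
  (is_derive_expR _) (is_derive_mulln (Re w) t0).
have D2 := @is_derive1_comp _ _ (fun t => Im w * ln t) _ _ _
  (is_derive_cos _) (is_derive_mulln (Im w) t0).
apply: (is_derive_eq (is_deriveM D1 D2)).
rewrite cpowB1// [in RHS]mulrA complexReMr complexReM Re_cpow Im_cpow /GRing.scale /=; ring.
Qed.

Lemma is_derive_Im_cpow (t : R) (w : R[i]) : 0 < t ->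
  is_derive t (1 : R) (fun t => Im (cpow t w)) (Im (w * cpow t (w - 1))).
Proof.
move=> t0; have -> : (fun t => Im (cpow t w)) =
  (fun t => expR (Re w * ln t) * sin (Im w * ln t)) by apply/funext => x; rewrite Im_cpow.
have D1 := @is_derive1_comp _ _ (fun t => Re w * ln t) _ _ _
  (is_derive_expR _) (is_derive_mulln (Re w) t0).
have D2 := @is_derive1_comp _ _ (fun t => Im w * ln t) _ _ _
  (is_derive_sin _) (is_derive_mulln (Im w) t0).
apply: (is_derive_eq (is_deriveM D1 D2)).
rewrite cpowB1// [in RHS]mulrA complexImMr complexImM Re_cpow Im_cpow /GRing.scale /=; ring.
Qed.

Lemma cvg_le_harmonic (u : nat -> R) (K : R) :
  (forall n, `|u n| <= K / n.+1%:R) -> u n @[n --> \oo] --> (0 : R).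
Proof.
move=> H; apply: norm_cvg0.
have C : (fun n => K * harmonic n) @ \oo --> (0 : R).
  by rewrite -[X in _ --> X](mulr0 K); apply: cvgM; [exact: cvg_cst|exact: cvg_harmonic].
by apply: (squeeze_cvgr _ (cvg_cst 0) C); apply: nearW => n; rewrite normr_ge0 H.
Qed.

(** Boundary terms of the integration by parts for Gamma. At 1/(n+1) the power is at most 1/(n+1)
    because a > 1; at n + 2 it is at most a constant times e^((n+2)/2), and half of the exponential
    decay is left. *)
Lemma gamma_boundary (u : R -> R) (a : R) : 1 < a ->
  (forall t, `|u t| <= expR (a * ln t)) ->
  u (n.+1%:R^-1) * expR (- n.+1%:R^-1) @[n --> \oo] --> (0 : R) /\
  u n.+2%:R * expR (- n.+2%:R) @[n --> \oo] --> (0 : R).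
Proof.
move=> a1 ua; have a0 : 0 < a by apply: lt_trans a1.
split.
  apply: (@cvg_le_harmonic _ 1) => n; rewrite normrM (ger0_norm (expR_ge0 _)).
  have e1 : expR (- n.+1%:R^-1) <= 1 :> R.
    by rewrite -[leRHS]expR0 ler_expR oppr_le0 invr_ge0.
  apply: (@le_trans _ _ (expR (a * ln n.+1%:R^-1) * 1)).
    by apply: ler_pM => //; exact: expR_ge0.
  rewrite mulr1 div1r -[leRHS]lnK ?posrE ?invr_gt0// ler_expR lnV ?posrE//.
  rewrite mulrN lerN2 -[leLHS]mul1r ler_wpM2r ?(ltW a1)//.
  by rewrite ln_ge0// ler1n.
apply: (@cvg_le_harmonic _ (expR (a * (ln (2 * a) - 1)) * 2)) => n.
rewrite normrM (ger0_norm (expR_ge0 _)).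
apply: le_trans (ler_wpM2r (expR_ge0 _) (ua _)) _.
rewrite -expRD.
apply: (@le_trans _ _ (expR (a * (ln (2 * a) - 1)) * expR (- (n.+2%:R / 2)))).
  rewrite -expRD ler_expR; have := @mulr_ln_le _ a n.+2%:R a0 (ltr0n _ _); lra.
rewrite -mulrA ler_wpM2l ?expR_ge0//.
rewrite expRN -[leRHS]invrK lef_pV2 ?posrE ?expR_gt0 ?invr_gt0 ?divr_gt0//.
rewrite invf_div; apply: le_trans (expR_ge1Dx _).
rewrite -[X in _ <= 1 + X / _]natr1; lra.
Qed.

(** The integrand is the derivative of t^w e^-t. It is written as a combination of the integrands of
    [Gamma w] and [Gamma (w + 1)], whence the exponent [w + 1 - 1]. *)
Lemma Cint_gamma_derive (w : R[i]) : 1 < Re w ->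
  Cint (fun t => w * (cpow t (w - 1) * (expR (- t))%:C)
     + (- 1) * (cpow t (w + 1 - 1) * (expR (- t))%:C)) = 0.
Proof.
move=> w1.
have w2 : 1 < Re (w + 1) by rewrite complexReD /= (lt_trans w1)// ltrDl.
have [p1 _] := CposintZ w (Cposint_gamma w1).
have [p2 _] := CposintZ (-1) (Cposint_gamma w2).
have [[pR pI] _] := CposintD p1 p2.
apply: complex_ext.
- rewrite Re_Cint.
  pose f t := Re (w * cpow t (w - 1)) * expR (- t) - Re (cpow t w) * expR (- t).
  have fE t : Re (w * (cpow t (w - 1) * (expR (- t))%:C)
     + (- 1) * (cpow t (w + 1 - 1) * (expR (- t))%:C)) = f t.
    by rewrite addrK complexReD mulrA complexReMr mulN1r complexReN complexReMr.
  rewrite (@eq_posRint R _ f); last by move=> t _; rewrite fE.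
  have [b0 boo] := gamma_boundary w1 (fun t => normRe_cpow t w).
  apply: (Rintegral_derive0 (F := fun t => Re (cpow t w) * expR (- t))) => //.
  + move=> t t0; apply: (is_derive_eq (is_deriveM
      (is_derive_Re_cpow w t0) (is_derive_expRN t))).
    by rewrite /f /GRing.scale /=; ring.
  + move=> t t0.
    have D1 := is_derive_Re_cpow (w - 1) t0.
    have D1' := is_derive_Im_cpow (w - 1) t0.
    have D2 := is_derive_Re_cpow w t0.
    have D3 := is_derive_expRN t.
    have -> : f = (fun t => (Re w * Re (cpow t (w - 1)) - Im w * Im (cpow t (w - 1)))
        * expR (- t) - Re (cpow t w) * expR (- t)).
      by apply/funext => x; rewrite /f complexReM.
    have [] := is_deriveB (is_deriveM (is_deriveB (is_deriveZ (Re w) D1)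
      (is_deriveZ (Im w) D1')) D3) (is_deriveM D2 D3).
    by move=> /derivable1_diffP/differentiable_continuous.
  + by apply: posint_eq pR => t _ /=; rewrite fE.
- rewrite Im_Cint.
  pose f t := Im (w * cpow t (w - 1)) * expR (- t) - Im (cpow t w) * expR (- t).
  have fE t : Im (w * (cpow t (w - 1) * (expR (- t))%:C)
     + (- 1) * (cpow t (w + 1 - 1) * (expR (- t))%:C)) = f t.
    by rewrite addrK complexImD mulrA complexImMr mulN1r complexImN complexImMr.
  rewrite (@eq_posRint R _ f); last by move=> t _; rewrite fE.
  have [b0 boo] := gamma_boundary w1 (fun t => normIm_cpow t w).
  apply: (Rintegral_derive0 (F := fun t => Im (cpow t w) * expR (- t))) => //.
  + move=> t t0; apply: (is_derive_eq (is_deriveM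
      (is_derive_Im_cpow w t0) (is_derive_expRN t))).
    by rewrite /f /GRing.scale /=; ring.
  + move=> t t0.
    have D1 := is_derive_Re_cpow (w - 1) t0.
    have D1' := is_derive_Im_cpow (w - 1) t0.
    have D2 := is_derive_Im_cpow w t0.
    have D3 := is_derive_expRN t.
    have -> : f = (fun t => (Re w * Im (cpow t (w - 1)) + Im w * Re (cpow t (w - 1)))
        * expR (- t) - Im (cpow t w) * expR (- t)).
      by apply/funext => x; rewrite /f complexImM.
    have [] := is_deriveB (is_deriveM (is_deriveD (is_deriveZ (Re w) D1')
      (is_deriveZ (Im w) D1)) D3) (is_deriveM D2 D3).
    by move=> /derivable1_diffP/differentiable_continuous.
  + by apply: posint_eq pI => t _ /=; rewrite fE.
Qed.

Lemma GammaS (w : R[i]) : 1 < Re w -> Gamma (w + 1) = w * Gamma w.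
Proof.
move=> w1.
have w2 : 1 < Re (w + 1) by rewrite complexReD /= (lt_trans w1)// ltrDl.
have [p1 e1] := CposintZ w (Cposint_gamma w1).
have [p2 e2] := CposintZ (-1) (Cposint_gamma w2).
have [_ e] := CposintD p1 p2.
have := Cint_gamma_derive w1; rewrite e e1 e2 mulN1r => /eqP.
by rewrite subr_eq0 => /eqP.
Qed.

Lemma Gamma_addn (w : R[i]) n : 1 < Re w ->
  Gamma (w + n%:R) = (\prod_(i < n) (w + i%:R)) * Gamma w.
Proof.
move=> w1; elim: n => [|n IH]; first by rewrite addr0 big_ord0 mul1r.
rewrite big_ord_recr/= mulrAC -IH -natr1 addrA GammaS 1?mulrC//.
rewrite complexReD (lt_le_trans w1)// lerDl.
by elim: n {IH} => // n IH; rewrite -natr1 complexReD addr_ge0 //= ler01.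
Qed.

End gamma.

(** * Nonvanishing of the Gamma function *)

Section gamma_neq0.
Variable R : realType.
Local Notation mu := (@lebesgue_measure R).
Local Notation D := (`]0%R, +oo[%classic : set (measurableTypeR R)).
Local Notation Re := (@complex.Re R).
Local Notation Im := (@complex.Im R).

Lemma sin_le_id (x : R) : 0 <= x -> `|sin x| <= x.
Proof.
rewrite le_eqVlt => /predU1P[<-|x0]; first by rewrite sin0 normr0.
have [|c _] := @MVT R sin cos 0 x x0 (fun t _ => is_derive_sin t).
  by apply: continuous_subspaceT => ?; exact: continuous_sin.
rewrite sin0 !subr0 => ->; rewrite normrM (gtr0_norm x0) -[leRHS]mul1r.
by rewrite ler_wpM2r ?(ltW x0)// ler_norml cos_geN1 cos_le1.
Qed.

Lemma onem_cos_le (x : R) : 1 - cos x <= x ^+ 2 / 2.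
Proof.
have -> : cos x = 1 - 2 * sin (x / 2) ^+ 2.
  rewrite [in LHS](splitr x) cosD -!expr2 cos2sin2; ring.
have : sin (x / 2) ^+ 2 <= (x / 2) ^+ 2.
  rewrite -(real_normK (num_real (sin _))) -(real_normK (num_real (x / 2))).
  rewrite ler_pXn2r ?nnegrE//; have [x0|x0] := leP 0 (x / 2).
    by rewrite (ger0_norm x0) sin_le_id.
  by rewrite (ltr0_norm x0) -normrN -sinN sin_le_id// oppr_ge0 ltW.
rewrite expr_div_n; lra.
Qed.

(** With v = u/2 the bracket is (e^v - e^-v)^2 >= v^2. Taken at u = ln (t / N), it replaces a
    squared logarithm by powers of t, whose moments are Gamma values. *)
Lemma sqr_le_expR (u : R) : u ^+ 2 <= 4 * (expR u + expR (- u) - 2).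
Proof.
pose v := u / 2; have -> : u = v + v by rewrite /v -splitr.
have vn : expR v * expR (- v) = 1 by rewrite -expRD subrr expR0.
have -> : expR (v + v) + expR (- (v + v)) - 2 = (expR v - expR (- v)) ^+ 2.
  rewrite opprD !expRD (_ : (expR v - expR (- v)) ^+ 2 =
    expR v * expR v + expR (- v) * expR (- v) - 2 * (expR v * expR (- v))); last by ring.
  by rewrite vn mulr1.
have -> : (v + v) ^+ 2 = 4 * v ^+ 2 by ring.
rewrite ler_pM2l//; have h1 := expR_ge1Dx v; have h2 := expR_ge1Dx (- v).
have [v0|v0] := leP 0 v.
  have : expR (- v) <= 1 by rewrite -[leRHS]expR0 ler_expR oppr_le0.
  by move=> ?; rewrite ler_pXn2r ?nnegrE//; lra.
have : expR v <= 1 by rewrite -[leRHS]expR0 ler_expR ltW.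
by move=> ?; rewrite -sqrrN -[leRHS]sqrrN ler_pXn2r ?nnegrE//; lra.
Qed.

Definition Gammar (a : R) : R :=
  Rintegral mu D (fun t => expR ((a - 1) * ln t) * expR (- t)).

Lemma Re_Gamma_real (a : R) : Re (Gamma a%:C) = Gammar a.
Proof.
apply: eq_posRint => t t0; rewrite complexReMr Re_cpow complexReD complexImD /=.
by rewrite subr0 mul0r cos0 mulr1.
Qed.

Lemma GammarS (a : R) : 1 < a -> Gammar (a + 1) = a * Gammar a.
Proof.
move=> a1; have := @GammaS R a%:C a1.
have -> : a%:C + 1 = (a + 1)%:C :> R[i] by rewrite rmorphD.
by move=> /(congr1 Re); rewrite mulrC complexReMr !Re_Gamma_real mulrC.
Qed.

(** On [1, 2] the integrand is at least e^-2. *)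
Lemma Gammar_gt0 (a : R) : 1 < a -> 0 < Gammar a.
Proof.
move=> a1; pose A : set (measurableTypeR R) := `[(1 : R), 2]%classic.
have mA : measurable A by exact: measurable_itv.
have AD : A `<=` D.
  move=> t; rewrite /A /= !in_itv/= andbT => /andP[+ _].
  exact: lt_le_trans.
have E : Rintegral mu D ((fun=> expR (-2)) \_ A) = expR (- 2).
  rewrite -Rintegral_mkcondr setIidr// Rintegral_cst//.
  have muA : mu A = 1%:E.
    rewrite [LHS](lebesgue_measure_itv `[(1 : R), 2]) /= lte_fin ltr1n /= -EFinB.
    by congr EFin; lra.
  by rewrite [fine _](_ : _ = 1) ?mulr1// -[1]/(fine 1%:E) -muA.
have g0 : (0 : R) < expR (- 2) by exact: expR_gt0.
apply: lt_le_trans g0 _; rewrite -{1}E; apply: le_Rintegral.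
- exact: measurable_Rpos.
- have : mu.-integrable A (EFin \o (fun=> expR (- 2) : R)).
    apply: continuous_compact_integrable; first exact: segment_compact.
    by apply: continuous_subspaceT => ?; exact: cvg_cst.
  rewrite -{1}(setIidr AD) setIC => H.
  have := (@integrable_restrict _ _ _ mu A mA D (@measurable_Rpos R) _).1.
  by rewrite setIC => /(_ _ H); rewrite restrict_EFin.
- exact: posint_gamma.
- move=> t Dt; have t0 : 0 < t by move: Dt; rewrite /= in_itv/= andbT.
  case: ifPn => [|_].
    rewrite inE /A /= in_itv/= => /andP[t1 t2].
    rewrite -expRD ler_expR; have : 0 <= (a - 1) * ln t.
      by rewrite mulr_ge0 ?ln_ge0// subr_ge0 ltW.
    lra.
  change (0 <= expR ((a - 1) * ln t) * expR (- t)).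
  by rewrite mulr_ge0// expR_ge0.
Qed.

(* For [N = Re s - 1] and [theta t = Im s * ln (t / N)] the integral of
   [t ^ N * e ^ (- t) * cos (theta t)] is [Re (N ^ (- i Im s) * Gamma s)], while
   [1 - cos theta <= theta ^ 2 / 2 <= 2 (Im s) ^ 2 (t / N + N / t - 2)], whose moment is
   computed by the recursion for Gamma. *)
Lemma Gamma_neq0_large (s : R[i]) : 2 < Re s -> 2 * Im s ^+ 2 < Re s - 1 ->
  Gamma s != 0.
Proof.
move=> s2 ts; apply/eqP => G0.
have s1 : 1 < Re s by apply: lt_trans s2; rewrite ltr1n.
set N := Re s - 1 in ts; have N1 : 1 < N by rewrite /N; lra.
have N0 : 0 < N by apply: lt_trans N1.
pose tau := Im s; pose g t := expR (N * ln t) * expR (- t) : R.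
have [pc ps] := Cposint_gamma s1.
have EN : Re (s - 1) = N by rewrite complexReD.
have Et : Im (s - 1) = tau by rewrite complexImD /= subr0.
pose fc t := g t * cos (tau * ln t); pose fs t := g t * sin (tau * ln t).
have fcE t : Re (cpow t (s - 1) * (expR (- t))%:C) = fc t.
  by rewrite complexReMr Re_cpow EN Et mulrAC.
have fsE t : Im (cpow t (s - 1) * (expR (- t))%:C) = fs t.
  by rewrite complexImMr Im_cpow EN Et mulrAC.
have {}pc : posint fc by apply: posint_eq pc => t _; exact: fcE.
have {}ps : posint fs by apply: posint_eq ps => t _; exact: fsE.
have Ic : Rintegral mu D fc = 0.
  by rewrite -(eq_posRint (fun t _ => fcE t)) -Re_Cint -[Cint _]/(Gamma s) G0.
have Is : Rintegral mu D fs = 0.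
  by rewrite -(eq_posRint (fun t _ => fsE t)) -Im_Cint -[Cint _]/(Gamma s) G0.
have mD := @measurable_Rpos R.
pose th t := tau * ln t - tau * ln N.
pose h t := cos (tau * ln N) * fc t + sin (tau * ln N) * fs t.
have hE t : h t = g t * cos (th t).
  by rewrite /h /th /fc /fs cosB; ring.
have ph : posint h by exact: posintD (posintZ _ pc) (posintZ _ ps).
have Ih : Rintegral mu D h = 0.
  by rewrite (RintegralD mD (posintZ _ pc) (posintZ _ ps))
    (RintegralZl _ mD pc) (RintegralZl _ mD ps) Ic Is !mulr0 addr0.
have pg : posint g by exact: posint_gamma.
have N11 : 1 < N + 1 + 1 by lra.
have N2 : 1 < N + 1 by lra.
pose g2 t := expR ((N + 1 + 1 - 1) * ln t) * expR (- t) : R.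
pose g0 t := expR ((N - 1) * ln t) * expR (- t) : R.
have p2 : posint g2 by exact: posint_gamma.
have p0 : posint g0 by exact: posint_gamma.
have Ig : Rintegral mu D g = Gammar (N + 1).
  by apply: eq_posRint => t _; rewrite addrK.
pose K := 2 * tau ^+ 2.
pose b t := K / N * g2 t + (K * N * g0 t - 2 * K * g t).
have pb : posint b.
  by apply: posintD; [exact: posintZ|apply: posintB; exact: posintZ].
have bE t : 0 < t -> b t = K * g t * (t / N + N / t - 2).
  move=> t0; rewrite /b.
  have -> : g2 t = g t * t.
    by rewrite /g2 /g addrK mulrDl mul1r expRD lnK ?posrE//; ring.
  have -> : g0 t = g t / t.
    by rewrite /g0 /g mulrBl mul1r expRB lnK ?posrE//; ring.
  by field; rewrite !gt_eqF.
(* The moments of t/N, N/t and -2 add up to ((N+1)/N + 1 - 2) Gamma(N+1), leaving the small factor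
   K/N < 1. The recursion at [N] uses 1 < N, that is, 2 < Re s. *)
have Ib : Rintegral mu D b = K / N * Gammar (N + 1).
  have pa := posintZ (K * N) p0; have pa2 := posintZ (2 * K) pg.
  rewrite (RintegralD mD (posintZ (K / N) p2) (posintB pa pa2)) (RintegralB mD pa pa2).
  rewrite (RintegralZl _ mD p2) (RintegralZl _ mD p0) (RintegralZl _ mD pg) Ig.
  rewrite -[Rintegral mu D g2]/(Gammar (N + 1 + 1)) -[Rintegral mu D g0]/(Gammar N).
  rewrite (GammarS N2) (GammarS N1).
  by field; rewrite gt_eqF.
have key : Rintegral mu D g <= Rintegral mu D (fun t => h t + b t).
  apply: le_Rintegral => //; first exact: posintD.
  move=> t; rewrite /= in_itv/= andbT => t0; rewrite -/(g t) hE bE//.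
  have gt0 : 0 <= g t by rewrite mulr_ge0 ?expR_ge0.
  have E1 : expR (ln t - ln N) = t / N by rewrite expRB !lnK ?posrE.
  have E2 : expR (- (ln t - ln N)) = N / t by rewrite opprB expRB !lnK ?posrE.
  have := sqr_le_expR (ln t - ln N); rewrite E1 E2 => H1.
  have := onem_cos_le (th t); rewrite /th -mulrBr exprMn => H2.
  have H3 : tau ^+ 2 * (ln t - ln N) ^+ 2 <= tau ^+ 2 * (4 * (t / N + N / t - 2)).
    by rewrite ler_wpM2l// sqr_ge0.
  have H4 : 1 - cos (tau * (ln t - ln N)) <= K * (t / N + N / t - 2).
    by apply: le_trans H2 _; rewrite /K; lra.
  have := ler_wpM2l gt0 H4.
  move: (cos _) => C; move: (t / N + N / t - 2) => X; move: (g t) => G; lra.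
have := key; rewrite (RintegralD mD ph pb) Ih add0r Ib Ig.
have G1 : 0 < Gammar (N + 1) by apply: Gammar_gt0; rewrite ltrDr.
rewrite -{1}[Gammar _]mul1r ler_pM2r// ler_pdivlMr// mul1r.
by rewrite leNgt ts.
Qed.

(** Adding a natural number n > 2 (Im s)^2 preserves the imaginary part and reaches the region
    already treated; there Gamma is a product containing [Gamma s]. *)
Lemma Gamma_neq0 (s : R[i]) : 1 < Re s -> Gamma s != 0.
Proof.
move=> s1.
pose n := (Num.trunc (2 * Im s ^+ 2)).+1.
have nE : 2 * Im s ^+ 2 < n%:R by rewrite truncnS_gt.
have n1 : 1 <= n%:R :> R by rewrite ler1n.
have := @Gamma_neq0_large (s + n%:R); rewrite complexReDn complexImDn => H.
have : Gamma (s + n%:R) != 0 by apply: H; lra.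
by rewrite Gamma_addn// mulf_eq0 negb_or => /andP[].
Qed.

End gamma_neq0.

(** * Mellin transforms of Dirichlet series *)

Section mellin.
Variable R : realType.
Local Notation mu := (@lebesgue_measure R).
Local Notation D := (`]0%R, +oo[%classic : set (measurableTypeR R)).
Local Notation Re := (@complex.Re R).
Local Notation Im := (@complex.Im R).

Lemma cpow_real (x a : R) : cpow x a%:C = (expR (a * ln x))%:C.
Proof.
by apply: complex_ext; rewrite ?Re_cpow ?Im_cpow /= mul0r ?cos0 ?sin0 ?mulr1 ?mulr0.
Qed.

(** Substitution of n t for t: the integrand yields n^(1-w), the Jacobian the remaining 1/n. *)
Lemma Cint_gamma_scale (w : R[i]) (n : nat) : 1 < Re w -> (0 < n)%N ->
  Cposint (fun t => cpow t (w - 1) * (expR (- t) ^+ n)%:C) /\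
  Cint (fun t => cpow t (w - 1) * (expR (- t) ^+ n)%:C) =
    (cpow n%:R w)^-1 * Gamma w.
Proof.
move=> w1 n0; have k0 : (0 : R) < n%:R by rewrite ltr0n.
have [p e] := Cposint_scale k0 (Cposint_gamma w1).
have [p' e'] := CposintZ (cpow n%:R (w - 1))^-1 p.
have E t : 0 < t -> (cpow n%:R (w - 1))^-1 *
    (cpow (n%:R * t) (w - 1) * (expR (- (n%:R * t)))%:C) =
    cpow t (w - 1) * (expR (- t) ^+ n)%:C.
  move=> t0; rewrite cpowM// -mulrN expRM_natl mulrA mulrA mulVf ?mul1r//.
  exact: cpow_neq0.
split; first exact: Cposint_eq p'.
rewrite -(eq_Cint E) e' e cpowB1// invfM mulrA -[Cint _]/(Gamma w); congr (_ * _).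
by rewrite -mulrA -fmorphV invrK -rmorphM mulfV ?mulr1// gt_eqF.
Qed.

Lemma series_cpow_cvg (c : nat -> R) (C a : R) (d : nat) :
  (forall n, 0 <= c n) -> c 0%N = 0 -> (forall n, c n <= C * n%:R ^+ d) ->
  1 + d%:R < a -> cvgn (series (fun n => c n * expR (- a * ln n%:R))).
Proof.
move=> c0 c00 cC da.
have s1 : 1 < a - d%:R by lra.
have C0 : 0 <= C by have := le_trans (c0 1%N) (cC 1%N); rewrite expr1n mulr1.
have H : cvgn (series (fun n => c n.+1 * expR (- a * ln n.+1%:R))).
  apply: (@series_le_cvg _ _ (fun n => C * riemannR (a - d%:R) n)).
  - by move=> n; rewrite mulr_ge0// expR_ge0.
  - by move=> n; rewrite mulr_ge0// invr_ge0 powR_ge0.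
  - move=> n; have p : (0 : R) < n.+1%:R by [].
    apply: le_trans (ler_wpM2r (expR_ge0 _) (cC n.+1)) _.
    rewrite -mulrA ler_wpM2l//.
    rewrite /riemannR /powR gt_eqF// -expRN.
    rewrite -{1}[n.+1%:R]lnK ?posrE// -expRM_natl -expRD ler_expR.
    by rewrite mulrBl opprB -mulNr.
  - rewrite (_ : series _ = fun N => C * series (riemannR (a - d%:R)) N).
      by apply: is_cvgM; [exact: is_cvg_cst|exact: is_cvg_riemannR].
    by apply/funext => N; rewrite /series /= mulr_sumr.
apply/cvg_ex; exists (limn (series (fun n => c n.+1 * expR (- a * ln n.+1%:R)))).
rewrite -(cvg_shiftS (series _)).
have -> // : [sequence series (fun n => c n * expR (- a * ln n%:R)) n.+1]_n =
    series (fun n => c n.+1 * expR (- a * ln n.+1%:R)).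
by apply/funext => n; rewrite /series /= big_nat_recl// c00 mul0r add0r.
Qed.

Lemma mellin_partial (c : nat -> R) (w : R[i]) (N : nat) : c 0%N = 0 -> 1 < Re w ->
  Cposint (fun t => cpow t (w - 1) * (\sum_(0 <= n < N) c n * expR (- t) ^+ n)%:C) /\
  Cint (fun t => cpow t (w - 1) * (\sum_(0 <= n < N) c n * expR (- t) ^+ n)%:C) =
    (\sum_(0 <= n < N) (c n)%:C * (cpow n%:R w)^-1) * Gamma w.
Proof.
move=> c00 w1.
have T n : Cposint (fun t => (c n)%:C * (cpow t (w - 1) * (expR (- t) ^+ n)%:C)) /\
    Cint (fun t => (c n)%:C * (cpow t (w - 1) * (expR (- t) ^+ n)%:C)) =
    (c n)%:C * (cpow n%:R w)^-1 * Gamma w.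
  (* The integral of t^(w-1) alone has no meaning here; the coefficient [c 0 = 0] removes it. *)
  case: n => [|n].
    rewrite c00 rmorph0 !mul0r; have [p0 e0] := @Cposint0 R.
    split; first by apply: Cposint_eq p0 => t _; rewrite mul0r.
    by rewrite -[RHS]e0; apply: eq_Cint => t _; rewrite mul0r.
  have [p e] := Cint_gamma_scale w1 (ltn0Sn n).
  by have [p' ->] := CposintZ (c n.+1)%:C p; rewrite e mulrA.
have [p e] := Cposint_sum (index_iota 0 N) (fun n => (T n).1).
have E t : 0 < t -> \sum_(0 <= n < N) (c n)%:C * (cpow t (w - 1) * (expR (- t) ^+ n)%:C)
   = cpow t (w - 1) * (\sum_(0 <= n < N) c n * expR (- t) ^+ n)%:C.
  move=> _; rewrite rmorph_sum mulr_sumr; apply: eq_bigr => n _.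
  by rewrite rmorphM mulrCA.
split; first exact: Cposint_eq E p.
rewrite -(eq_Cint E) e mulr_suml; apply: eq_bigr => n _.
by rewrite (T n).2.
Qed.

(** Termwise integration in two passes. With [w] replaced by its real part all terms are
    nonnegative, and monotone convergence makes t^(Re w - 1) F(t) integrable; this function then
    dominates the partial sums for the complex [w]. *)
Lemma mellin (c : nat -> R) (F : R -> R) (C : R) (d : nat) (w : R[i]) :
  (forall n, 0 <= c n) -> c 0%N = 0 -> (forall n, c n <= C * n%:R ^+ d) ->
  (forall t, 0 < t -> pseries c (expR (- t)) N @[N --> \oo] --> F t) ->
  1 + d%:R < Re w ->
  Cposint (fun t => cpow t (w - 1) * (F t)%:C) /\
  Cint (fun t => cpow t (w - 1) * (F t)%:C) = Gamma w *
    limn (fun N => \sum_(0 <= n < N) (c n)%:C * (cpow n%:R w)^-1 : R[i]^o).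
Proof.
move=> c0 c00 cC cF dw.
have w1 : 1 < Re w by apply: le_lt_trans dw; rewrite lerDl.
pose S N t := pseries c (expR (- t)) N.
have S0 N t : 0 <= S N t.
  by apply: sumr_ge0 => n _; rewrite mulr_ge0// exprn_ge0// expR_ge0.
have Snd t : nondecreasing_seq (S ^~ t).
  by apply: nondecreasing_series => n _ _; rewrite mulr_ge0// exprn_ge0// expR_ge0.
have SF N t : 0 < t -> S N t <= F t.
  move=> t0; rewrite -(cvg_lim (@Rhausdorff R) (cF t t0)).
  by apply: nondecreasing_cvgn_le; [exact: Snd|exact: (cvgP _ (cF t t0))].
have hs := series_cpow_cvg c0 c00 cC dw.
set sc := fun n => _ in hs.
pose g t := expR ((Re w - 1) * ln t) * F t.
have pg : posint g.
  apply: (@posint_monotone _ (fun N t => expR ((Re w - 1) * ln t) * S N t) g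
    (limn (series sc) * Gammar (Re w))).
  - move=> N; have [[p _] _] := @mellin_partial c (Re w)%:C N c00 w1.
    apply: posint_eq p => t _.
    by rewrite [(_ \o _) t]complexReMr Re_cpow complexReD complexImD /= subr0 mul0r cos0 mulr1.
  - by move=> N t _; rewrite mulr_ge0// expR_ge0.
  - by move=> t _ m n mn; rewrite ler_wpM2l ?expR_ge0//; exact: Snd.
  - by move=> t t0; apply: cvgM; [exact: cvg_cst|exact: cF].
  - move=> N; have [_ e] := @mellin_partial c (Re w)%:C N c00 w1.
    have := congr1 Re e; rewrite Re_Cint.
    rewrite (@eq_posRint R _ (fun t => expR ((Re w - 1) * ln t) * S N t)); last first.
      move=> t _; rewrite complexReMr Re_cpow complexReD complexImD /=.
      by rewrite subr0 mul0r cos0 mulr1.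
    move=> ->.
    have -> : \sum_(0 <= n < N) (c n)%:C * (cpow n%:R (Re w)%:C)^-1 = (series sc N)%:C.
      rewrite rmorph_sum; apply: eq_bigr => n _.
      by rewrite /sc rmorphM mulNr expRN fmorphV cpow_real.
    rewrite mulrC complexReMr Re_Gamma_real mulrC ler_wpM2r ?(ltW (Gammar_gt0 _))//.
    apply: nondecreasing_cvgn_le => //; apply: nondecreasing_series => n _ _.
    by rewrite mulr_ge0// expR_ge0.
have EN : Re (w - 1) = Re w - 1 by rewrite complexReD.
pose P N t := cpow t (w - 1) * (S N t)%:C.
have pP N : Cposint (P N) by have [] := @mellin_partial c w N c00 w1.
have eP N : Cint (P N) = (\sum_(0 <= n < N) (c n)%:C * (cpow n%:R w)^-1) * Gamma w.
  by have [] := @mellin_partial c w N c00 w1.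
have [|||||||pf cR cI] := @Cposint_dominated R P (fun t => cpow t (w - 1) * (F t)%:C) g.
- by move=> N; have [/posint_measurable] := pP N.
- by move=> N; have [_ /posint_measurable] := pP N.
- move=> t t0; rewrite complexReMr.
  rewrite (_ : (fun n => Re (P n t)) = (fun n => Re (cpow t (w - 1)) * S n t)).
    by apply: cvgM; [exact: cvg_cst|exact: cF].
  by apply/funext => n; rewrite complexReMr.
- move=> t t0; rewrite complexImMr.
  rewrite (_ : (fun n => Im (P n t)) = (fun n => Im (cpow t (w - 1)) * S n t)).
    by apply: cvgM; [exact: cvg_cst|exact: cF].
  by apply/funext => n; rewrite complexImMr.
- exact: pg.
- move=> N t t0; rewrite complexReMr normrM (ger0_norm (S0 _ _)).
  by apply: ler_pM => //; [rewrite -EN normRe_cpow|exact: SF].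
- move=> N t t0; rewrite complexImMr normrM (ger0_norm (S0 _ _)).
  by apply: ler_pM => //; [rewrite -EN normIm_cpow|exact: SF].
split=> //.
have G0 := Gamma_neq0 w1.
set I := Cint _ in cR cI *.
(* Convergence of the complex Dirichlet series comes out of the convergence of the integrals, at the
   price of dividing by [Gamma w]. *)
have -> : limn (fun N => \sum_(0 <= n < N) (c n)%:C * (cpow n%:R w)^-1 : R[i]^o) =
    (Gamma w)^-1 * I.
  apply: cvg_lim; first exact: norm_hausdorff.
  rewrite (_ : (fun N => _) = (fun N => (Gamma w)^-1 * Cint (P N))); last first.
    by apply/funext => N; rewrite eP mulrCA mulVf// mulr1.
  by apply: cvg_complex; rewrite ?complexReM ?complexImM;
    (under eq_fun do rewrite ?complexReM ?complexImM);
    [apply: cvgB|apply: cvgD]; apply: cvgM => //; exact: cvg_cst.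
by rewrite mulrA mulfV// mul1r.
Qed.

Lemma mcoef_complex ks n : mcoef R[i] ks n = (mcoef R ks n)%:C.
Proof.
elim: ks n => [|k ks IH] n; first by rewrite /mcoef rmorph_nat.
rewrite !mcoef_cons rmorphM fmorphV rmorphXn rmorph_nat rmorph_sum.
by congr (_ / _); apply: eq_bigr => m _.
Qed.

Lemma zetaE (w : R[i]) : zeta w =
  limn (fun N => \sum_(0 <= n < N) (mcoef R [:: 0%N] n)%:C * (cpow n%:R w)^-1 : R[i]^o).
Proof.
apply: (@limn_shift_eq R[i]^o) => N; rewrite [RHS]big_nat_recl// mcoef0 mul0r add0r.
rewrite big_add1 /=; apply: eq_bigr => n _.
by rewrite mcoef_single expr0 divr1 mul1r.
Qed.

Lemma mzetaE (l : nat) (w : R[i]) : mzeta [:: l] w =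
  limn (fun N => \sum_(0 <= n < N) (mcoef R [:: 0%N; l] n)%:C * (cpow n%:R w)^-1 : R[i]^o).
Proof.
have -> : (fun N => \sum_(0 <= n < N) (mcoef R [:: 0%N; l] n)%:C * (cpow n%:R w)^-1 : R[i]^o)
  = (fun N => \sum_(0 <= n < N) mcoef R[i] (rev [:: l; 0%N]) n * (cpow n%:R w)^-1).
  by apply/funext => N; apply: eq_bigr => n _; rewrite mcoef_complex.
rewrite -(multisum_mcoef [:: l; 0%N] (fun n => (cpow n%:R w)^-1)).
rewrite /mzeta; congr multisum; apply/funext => n.
by rewrite !big_ord_recl !big_ord0 /= expr0 !mulr1 invfM.
Qed.

Lemma zeta_nat k : zeta (k.+2%:R : R[i]) = (zetaR R k.+2)%:C.
Proof.
rewrite zetaE; apply: (@cvg_lim R[i]^o); first exact: norm_hausdorff.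
have E N : \sum_(0 <= n < N) (mcoef R [:: 0%N] n)%:C * (cpow n%:R (k.+2%:R : R[i]))^-1 =
    (series (mcoef R [:: k.+2]) N)%:C.
  rewrite rmorph_sum; apply: eq_bigr => -[|n] _; first by rewrite !mcoef0 mul0r.
  by rewrite cpow_nat// -fmorphV -rmorphM !mcoef_single expr0 divr1 !mul1r.
rewrite (funext E); apply: cvg_complex => /=; first exact: is_cvg_series_mcoef_single.
exact: cvg_cst.
Qed.

Lemma mellin_zeta (w : R[i]) : 1 < Re w ->
  Cposint (fun t => cpow t (w - 1) * ((expR t - 1)^-1)%:C) /\
  Cint (fun t => cpow t (w - 1) * ((expR t - 1)^-1)%:C) = Gamma w * zeta w.
Proof.
move=> w1; rewrite zetaE.
apply: (@mellin _ (fun t => (expR t - 1)^-1) 1 0); rewrite ?addr0//.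
- by move=> n; exact: mcoef_ge0.
- exact: mcoef0.
- by move=> n; rewrite expr0 mulr1; exact: mcoef_single_le1.
- move=> t t0; rewrite -polylog_single0//; apply: is_cvg_pseries_bounded.
    by apply: mcoef01 => n; exact: mcoef_single_le1.
  exact: expRN_lt1.
Qed.

(** Multiplication by x / (1 - x), which is 1 / (e^t - 1) at x = e^-t, takes partial sums of the
    coefficients and shifts them by one, whence the strict inequality of the two indices. *)
Lemma pseries_double_cvg l (t : R) : 0 < t ->
  pseries (mcoef R [:: 0%N; l]) (expR (- t)) N @[N --> \oo] -->
  Liexp l t / (expR t - 1).
Proof.
move=> t0; have xt := expRN_lt1 t0.
have e2 : expR t - 1 != 0 by rewrite subr_eq0 gt_eqF// expR_gt1.
have e1 : 1 - expR (- t) != 0.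
  by rewrite subr_eq0 gt_eqF// expR_lt1 oppr_lt0.
rewrite -(cvg_shiftS (pseries _ _)).
have -> : [sequence pseries (mcoef R [:: 0%N; l]) (expR (- t)) n.+1]_n =
    fun N => expR (- t) * pseries (fun n => \sum_(m < n.+1) mcoef R [:: l] m) (expR (- t)) N.
  apply/funext => N; rewrite /pseries /series /= big_nat_recl// mcoef0 mul0r add0r.
  rewrite mulr_sumr; apply: eq_bigr => i _; rewrite mcoef_cons expr0 divr1 exprS.
  by rewrite mulrCA.
have -> : Liexp l t / (expR t - 1) = expR (- t) * (Liexp l t / (1 - expR (- t))).
  rewrite mulrCA; congr (_ * _); apply: (mulIf e1); rewrite mulfVK//.
  by apply: (mulfI e2); rewrite mulVKf// mulrBl -expRD subrr expR0; ring.
apply: cvgM; first exact: cvg_cst.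
by apply: cvg_pseries_sum => //; apply: mcoef01 => n; exact: mcoef_single_le1.
Qed.

(** [d] is a growth exponent of the partial sums of m^-(l+1). For d = 0 the first condition forces l
    + 1 >= 2 and [zetaR] bounds them; otherwise n <= n^d is enough, even for harmonic numbers. *)
Lemma mellin_mzeta (l d : nat) (w : R[i]) : (0 < d + l)%N -> 1 + d%:R < Re w ->
  Cposint (fun t => cpow t (w - 1) * (Liexp l.+1 t / (expR t - 1))%:C) /\
  Cint (fun t => cpow t (w - 1) * (Liexp l.+1 t / (expR t - 1))%:C) =
    Gamma w * mzeta [:: l.+1] w.
Proof.
move=> dl w1; rewrite mzetaE.
have c0 n : 0 <= mcoef R [:: 0%N; l.+1] n by exact: mcoef_ge0.
have M (C : R) : (forall n, mcoef R [:: 0%N; l.+1] n <= C * n%:R ^+ d) ->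
  Cposint (fun t => cpow t (w - 1) * (Liexp l.+1 t / (expR t - 1))%:C) /\
  Cint (fun t => cpow t (w - 1) * (Liexp l.+1 t / (expR t - 1))%:C) = Gamma w *
    limn (fun N =>
      \sum_(0 <= n < N) (mcoef R [:: 0%N; l.+1] n)%:C * (cpow n%:R w)^-1 : R[i]^o).
  move=> cC; apply: (@mellin _ (fun t => Liexp l.+1 t / (expR t - 1)) C d) => //.
    exact: mcoef0.
  exact: pseries_double_cvg.
case: d dl w1 M => [|d] dl w1 M.
  case: l dl c0 M => // l _ _ M.
  apply: (M (zetaR R l.+2)) => // n.
  rewrite expr0 mulr1 mcoef_cons expr0 divr1.
  rewrite -(big_mkord xpredT (mcoef R [:: l.+2])).
  apply: nondecreasing_cvgn_le; last exact: is_cvg_series_mcoef_single.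
  by apply: nondecreasing_series => m _ _; exact: mcoef_ge0.
apply: (M 1) => n; rewrite mul1r mcoef_cons expr0 divr1.
apply: (@le_trans _ _ (\sum_(m < n) 1)).
  by apply: ler_sum => m _; exact: mcoef_single_le1.
rewrite sumr_const card_ord -natrX ler_nat.
by case: n => // n; rewrite -{1}(expn1 n.+1) leq_pexp2l.
Qed.

End mellin.

(** * Integration of the closed formula and conclusion *)

Lemma cpow_addn (R : realType) (t : R) (s : R[i]) n : 0 < t ->
  cpow t (s - 1) * (t ^+ n)%:C = cpow t (s + n%:R - 1).
Proof. by move=> t0; rewrite -cpow_nat// -cpowD addrAC. Qed.

Lemma Gamma_rbinom (R : realType) (s : R[i]) n : 1 < complex.Re s ->
  (Gamma s)^-1 * Gamma (s + n%:R) / n`!%:R = rbinom s n.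
Proof.
by move=> s1; rewrite Gamma_addn// mulrCA mulVf ?Gamma_neq0// mulr1.
Qed.

Lemma Cint_zetasum (R : realType) (j m : nat) (s : R[i]) :
  (0 < j)%N -> 1 < complex.Re s ->
  Cposint (fun t => cpow t (s - 1) / (expR t - 1)%:C * (zetasum j m t)%:C) /\
  (Gamma s)^-1 *
    Cint (fun t => cpow t (s - 1) / (expR t - 1)%:C * (zetasum j m t)%:C) =
  \sum_(i < m.+1) (-1) ^+ i * 'C(i + j, i)%:R * rbinom s (m - i)
    * zeta (i + j + 1)%:R * zeta (s + (m - i)%:R).
Proof.
move=> j0 s1.
pose A i : R := (-1) ^+ i * 'C(i + j, i)%:R * zetaR R (i + j + 1) / (m - i)`!%:R.
have w1 n : 1 < complex.Re (s + n%:R).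
  by rewrite complexReDn (lt_le_trans s1)// lerDl.
have T (i : 'I_m.+1) := CposintZ (A i)%:C (mellin_zeta (w1 (m - i)%N)).1.
have [p e] := Cposint_sum (index_enum 'I_m.+1) (fun i => (T i).1).
have E (t : R) : 0 < t -> \sum_(i < m.+1) (A i)%:C *
    (cpow t (s + (m - i)%:R - 1) * ((expR t - 1)^-1)%:C) =
    cpow t (s - 1) / (expR t - 1)%:C * (zetasum j m t)%:C.
  move=> t0; rewrite /zetasum rmorph_sum mulr_sumr; apply: eq_bigr => i _.
  rewrite -cpow_addn// /A /dpow -fmorphV !rmorphM; ring.
split; first exact: Cposint_eq E p.
rewrite -(eq_Cint E) e mulr_sumr; apply: eq_bigr => i _.
rewrite (T i).2 (mellin_zeta (w1 (m - i)%N)).2 -Gamma_rbinom//.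
(* Since j > 0 the argument is at least 2, inside the range of convergence. *)
have -> : zeta (i + j + 1)%:R = (zetaR R (i + j + 1))%:C.
  by case: j j0 {A T p e E} => // j _; rewrite addn1 addnS zeta_nat.
rewrite /A 3!rmorphM fmorphV rmorphXn rmorphN1 !rmorph_nat; ring.
Qed.

Lemma Cint_tailsum (R : realType) (j m : nat) (s : R[i]) :
  (0 < j)%N -> 1 < complex.Re s ->
  Cposint (fun t => cpow t (s - 1) / (expR t - 1)%:C * (tailsum j m t)%:C) /\
  (Gamma s)^-1 *
    Cint (fun t => cpow t (s - 1) / (expR t - 1)%:C * (tailsum j m t)%:C) =
  \sum_(q < j.+1) 'C(m + q, m)%:R * rbinom s (j - q)
    * mzeta [:: (m + q).+1] (s + (j - q)%:R).
Proof.
move=> j0 s1.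
pose A q : R := 'C(m + q, m)%:R / (j - q)`!%:R.
(* The power t^(j-q) pays for coefficient growth of order j - q. At q = j no growth is allowed, but
   then the first exponent m + j + 1 is at least 2. *)
have M (q : 'I_j.+1) := @mellin_mzeta R (m + q) (j - q) (s + (j - q)%:R).
have H1 (q : 'I_j.+1) : (0 < j - q + (m + q))%N by have := ltn_ord q; lia.
have H2 (q : 'I_j.+1) : 1 + (j - q)%:R < complex.Re (s + (j - q)%:R).
  by rewrite complexReDn ltrD2r.
have T (q : 'I_j.+1) := CposintZ (A q)%:C (M q (H1 q) (H2 q)).1.
have [p e] := Cposint_sum (index_enum 'I_j.+1) (fun i => (T i).1).
have E (t : R) : 0 < t -> \sum_(q < j.+1) (A q)%:C *
    (cpow t (s + (j - q)%:R - 1) * (Liexp (m + q).+1 t / (expR t - 1))%:C) =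
    cpow t (s - 1) / (expR t - 1)%:C * (tailsum j m t)%:C.
  move=> t0; rewrite /tailsum rmorph_sum mulr_sumr; apply: eq_bigr => q _.
  rewrite -cpow_addn// /A /dpow -fmorphV !rmorphM; ring.
split; first exact: Cposint_eq E p.
rewrite -(eq_Cint E) e mulr_sumr; apply: eq_bigr => q _.
rewrite (T q).2 (M q (H1 q) (H2 q)).2 -Gamma_rbinom//.
rewrite /A rmorphM fmorphV !rmorph_nat; ring.
Qed.

Theorem theorem2p16 (R : realType) (r j : nat) (s : R[i]) :
  (0 < j)%N -> (j <= r)%N -> 1 < complex.Re s ->
  xi (nseq j.-1 1%N ++ 2%N :: nseq (r - j) 1%N) s =
    \sum_(0 <= i < (r - j).+1)
      (-1) ^+ i * 'C(i + j, i)%:R * rbinom s (r - i - j)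
        * zeta (i + j + 1)%:R * zeta (s + (r - i - j)%:R)
    + (-1) ^ (r%:Z - j%:Z - 1) *
      \sum_((r - j)%N <= l < r.+1)
        'C(l, r - j)%:R * rbinom s (r - l)
          * mzeta [:: l.+1] (s + (r - l)%:R).
Proof.
move=> j0 jr s1; set m := (r - j)%N.
have [p1 e1] := Cint_zetasum m j0 s1.
have [p2 e2] := Cint_tailsum m j0 s1.
have [p3 e3] := CposintZ ((-1) ^+ m.+1) p2.
have [_ e] := CposintD p1 p3.
have E t : 0 < t ->
    cpow t (s - 1) / (expR t - 1)%:C * (zetasum j m t)%:C +
    (-1) ^+ m.+1 * (cpow t (s - 1) / (expR t - 1)%:C * (tailsum j m t)%:C) =
    cpow t (s - 1) / (expR t - 1)%:C *
      (Li (nseq j.-1 1%N ++ 2%N :: nseq m 1%N) (1 - expR (- t)))%:C.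
  (* Reversal moves the block of [m] ones to the front, where differentiation removes them one by
     one. *)
  move=> t0; rewrite LiE rev_cat rev_cons !rev_nseq cat_rcons polylog_formula//.
  rewrite (rmorphD (real_complex R) (zetasum j m t)).
  by rewrite (rmorphM (real_complex R) ((-1) ^+ m.+1)) rmorphXn rmorphN1 mulrDr mulrCA.
rewrite /xi -[Cintegral _ _]/(Cint _) -(eq_Cint E) e e3 mulrDr mulrCA e1 e2.
congr (_ + _ * _).
- rewrite big_mkord; apply: eq_bigr => i _.
  by rewrite -[(r - i - j)%N]subnAC.
(* The integer exponent r - j - 1 is -1 when j = r; since -1 is its own inverse, the sign agrees
   with (-1)^(m+1). *)
- by rewrite subzn// -/m expfzDr ?oppr_eq0 ?oner_eq0// exprSr exprN1 invrN1.
- rewrite -[RHS]/(\sum_((0 + m)%N <= l < r.+1) _) big_addn big_mkord subSn ?leq_subr// subKn//.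
  apply: eq_bigr => q _; rewrite [(q + m)%N]addnC.
  by have -> : (r - (m + q) = j - q)%N by rewrite /m; lia.
Qed.
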